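(* Let $L$ be a differential graded Lie algebra over $\mathbb{Q}$ whose homology $H=H(L)$ is an abelian graded Lie algebra (that is, the induced bracket on $H$ is zero), and let $x_1,x_2,x_3,x_4\in H$ be homogeneous classes such that $[x_1,x_2,x_3,x_4]_W\neq\emptyset$. Then, for any homotopy retract of $L$, with transferred brackets $\{\ell_j\}$ on $H$, $$\epsilon\,\ell_4(x_1,x_2,x_3,x_4)\in[x_1,x_2,x_3,x_4]_W,\qquad \epsilon=(-1)^{3|x_1|+2|x_2|+|x_3|}.$$
   Context: All vector spaces are $\mathbb{Z}$-graded over $\mathbb{Q}$; $|x|$ denotes degree. A DGL $(L,\partial)$ is a graded Lie algebra with a derivation $\partial$ of degree $-1$, $\partial^2=0$ (no boundedness is assumed). $\mathbb{L}(V)$ is the free graded Lie algebra on $V$. **Whitehead brackets.** Let $x_1,\dots,x_k\in H(L)$ be homogeneous, $n_j=|x_j|+1$ (here $k=4$). Let $U$ be the graded vector space with basis $u_{i_1\dots i_s}$, $1\le i_1<\dots<i_s\le k$, $1\le s<k$, $|u_{i_1\dots i_s}|=n_{i_1}+\dots+n_{i_s}-1$. $(\mathbb{L}(U),\partial)$ is the DGL with $\partial u_i=0$ and $$\partial u_{i_1\dots i_s}=\sum_{p=1}^{s-1}\sum_{\sigma\in\widetilde S(p,s-p)}\varepsilon(\sigma)\,[u_{i_{\sigma(1)}\dots i_{\sigma(p)}},u_{i_{\sigma(p+1)}\dots i_{\sigma(s)}}],$$ where $\widetilde S(p,s-p)$ is the set of $(p,s-p)$-shuffles with $\sigma(1)=1$,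 and $\varepsilon(\sigma)=(-1)^{|u_{i_{\sigma(1)}\dots i_{\sigma(p)}}|}\kappa$, with $\kappa$ the Koszul sign of permuting symbols of degrees $n_{i_1},\dots,n_{i_s}$ by $\sigma$. Let $\omega\in\mathbb{L}(U)$ be the cycle given by the right-hand side for $s=k$, $i_j=j$. The $k$th order Whitehead bracket set $[x_1,\dots,x_k]_W\subset H(L)$ is the (possibly empty) set of homology classes $\overline{\phi(\omega)}$, where $\phi\colon(\mathbb{L}(U),\partial)\to L$ runs over DGL morphisms such that $\phi(u_j)$ is a cycle representing $x_j$ for $j=1,\dots,k$. **Homotopy retracts.** A homotopy retract $(L,i,q,K)$ of $L$ consists of chain maps $i\colon(H,0)\to(L,\partial)$, a quasi-isomorphism inducing the identity on $H=H(L)$, and $q\colon(L,\partial)\to(H,0)$ with $qi=\mathrm{id}_H$, and a degree $1$ linear map $K\colon L\to L$ with $\mathrm{id}_L-iq=\partial K+K\partial$. **Transferred brackets.** A homotopy retract induces a minimal $L_\infty$ structure $\{\ell_j\}_{j\ge1}$ on $H$ ($\ell_1=0$) given for $k\ge2$ by $\ell_k=\sum_{T\in\mathscr{T}_k}\frac{1}{|\mathrm{Aut}(T)|}\,q\circ\widetilde\ell_T\circ\mathcal{S}_k$. Here $\mathscr{T}_k$ is the set of isomorphism classes of binary rooted trees with $k$ leaves, each drawn in the plane (trees differing by exchanging the two branches at a vertex are isomorphic), and $\mathrm{Aut}(T)$ is the automorphism group of the rooted tree. $\mathcal{S}_k(v_1\otimes\dots\otimes v_k)=\sum_{\sigma\in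 S_k}\varepsilon_\sigma\varepsilon\,v_{\sigma(1)}\otimes\dots\otimes v_{\sigma(k)}$, with $\varepsilon_\sigma$ the signature and $\varepsilon$ the Koszul sign. $\widetilde\ell_T\colon H^{\otimes k}\to L$ is obtained by composing down from the leaves to the root, labelling leaves by $i$, internal edges by $K$, and each internal vertex by $(-1)^{p-1}[\,,]$, with $p$ the number of leaves above its left input; tensor products of maps are evaluated by $(f\otimes g)(a\otimes b)=(-1)^{|g||a|}f(a)\otimes g(b)$. *)

(* Defs.v *)
From HB Require Import structures.
From mathcomp Require Import all_boot all_order all_fingroup all_algebra generic_quotient.
From mathcomp Require Import boolp.

Set Implicit Arguments.
Unset Strict Implicit.
Unset Printing Implicit Defensive.

Import GRing.Theory Num.Theory.
Local Open Scope ring_scope.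
Local Open Scope quotient_scope.

(* A Z-graded rational vector space is given by its total space V together
   with the predicates "homogeneous of degree n"; the two last axioms say
   that V is the direct sum of its homogeneous parts. *)
HB.mixin Record isGraded V of GRing.Lmodule rat V := {
  homog : int -> V -> Prop;
  homog_lin : forall n (a : rat) (x y : V),
    homog n x -> homog n y -> homog n (a *: x + y);
  homog_decomp : forall x : V, exists (s : seq int) (f : int -> V),
    [/\ uniq s, forall n, homog n (f n) & x = \sum_(n <- s) f n];
  homog_indep : forall (s : seq int) (f : int -> V),
    uniq s -> (forall n, homog n (f n)) -> \sum_(n <- s) f n = 0 ->
    forall n, n \in s -> f n = 0
}.

#[short(type="gradedModType")]
HB.structure Definition GradedMod := {V of isGraded V & GRing.Lmodule rat V}.

HB.mixin Record hasBracket V of GradedMod V := {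
  brk : V -> V -> V;
  brk_linl : forall y : V, linear (brk^~ y);
  brk_linr : forall x : V, linear (brk x);
  brk_homog : forall m n (x y : V),
    homog m x -> homog n y -> homog (m + n) (brk x y);
  brk_antisym : forall m n (x y : V), homog m x -> homog n y ->
    brk x y = - ((-1) ^ (m * n) *: brk y x);
  brk_jacobi : forall m n p (x y z : V), homog m x -> homog n y -> homog p z ->
    brk x (brk y z) = brk (brk x y) z + (-1) ^ (m * n) *: brk y (brk x z)
}.

#[short(type="gradedLieType")]
HB.structure Definition GradedLie := {V of hasBracket V & GradedMod V}.

(* The square of the derivation need not vanish: the differential of L(U)
   below can then be packaged before knowing that it squares to zero. *)
HB.mixin Record hasDerivation V of GradedLie V := {
  diff : {linear V -> V};
  diff_homog : forall n (x : V), homog n x -> homog (n - 1) (diff x);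
  diff_brk : forall m (x y : V), homog m x ->
    diff (brk x y) = brk (diff x) y + (-1) ^ m *: brk x (diff y)
}.

#[short(type="diffLieType")]
HB.structure Definition DiffLie := {V of hasDerivation V & GradedLie V}.

HB.mixin Record isDGL V of DiffLie V := {
  diff_diff : forall x : V, diff (diff x) = 0
}.

#[short(type="dglType")]
HB.structure Definition DGL := {V of isDGL V & DiffLie V}.

Definition abelian_lie (L : gradedLieType) := forall x y : L, brk x y = 0.

Definition graded_map (V W : gradedModType) (e : int) (f : V -> W) :=
  forall n x, homog n x -> homog (n + e) (f x).

Definition dgl_morphism (M L : diffLieType) (f : {linear M -> L}) :=
  [/\ graded_map 0 f,
      forall x y, f (brk x y) = brk (f x) (f y)
    & forall x, f (diff x) = diff (f x)].

Lemma sum_restrict (V : zmodType) (s t : seq int) (f : int -> V) : uniq s -> uniq t ->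
  {subset s <= t} -> \sum_(n <- t) (if n \in s then f n else 0) = \sum_(n <- s) f n.
Proof.
move=> us ut st; rewrite -big_mkcond -big_filter; apply: perm_big.
apply: uniq_perm; rewrite ?filter_uniq // => n; rewrite mem_filter.
by case: (boolP (n \in s)) => //= /st.
Qed.

Section GradedTheory.
Variable V : gradedModType.
Implicit Types x y : V.

Lemma homogD n x y : homog n x -> homog n y -> homog n (x + y).
Proof. by move=> hx hy; rewrite -[x]scale1r; apply: homog_lin. Qed.

Lemma homog0 n : homog n (0 : V).
Proof.
have [s [f [_ hf _]]] := homog_decomp (0 : V).
by rewrite -[0](subrr (f n)) addrC -scaleN1r; apply: homog_lin.
Qed.

Lemma homogZ n a x : homog n x -> homog n (a *: x).
Proof. by move=> hx; rewrite -[_ *: _]addr0; apply: homog_lin => //; apply: homog0. Qed.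

Lemma homogN n x : homog n x -> homog n (- x).
Proof. by rewrite -scaleN1r; apply: homogZ. Qed.

Lemma homogB n x y : homog n x -> homog n y -> homog n (x - y).
Proof. by move=> hx hy; apply: homogD => //; apply: homogN. Qed.

Lemma homog_sum n (I : Type) (r : seq I) (P : pred I) (F : I -> V) :
  (forall i, P i -> homog n (F i)) -> homog n (\sum_(i <- r | P i) F i).
Proof.
move=> hF; elim/big_ind: _ => //; first exact: homog0.
by move=> x y; apply: homogD.
Qed.

End GradedTheory.

Section BracketTheory.
Variable L : gradedLieType.
Implicit Types x y z : L.

Lemma brkDl x x' y : brk (x + x') y = brk x y + brk x' y.
Proof. by have := brk_linl y 1 x x'; rewrite !scale1r. Qed.

Lemma brkDr x y y' : brk x (y + y') = brk x y + brk x y'.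
Proof. by have := brk_linr x 1 y y'; rewrite !scale1r. Qed.

Lemma brk0l y : brk 0 y = 0.
Proof. by apply/(addrI (brk 0 y)); rewrite -brkDl !addr0. Qed.

Lemma brk0r x : brk x 0 = 0.
Proof. by apply/(addrI (brk x 0)); rewrite -brkDr !addr0. Qed.

Lemma brkZl a x y : brk (a *: x) y = a *: brk x y.
Proof. by have := brk_linl y a x 0; rewrite !addr0 /= brk0l addr0. Qed.

Lemma brkZr a x y : brk x (a *: y) = a *: brk x y.
Proof. by have := brk_linr x a y 0; rewrite !addr0 /= brk0r addr0. Qed.

Lemma brkBl x x' y : brk (x - x') y = brk x y - brk x' y.
Proof. by rewrite brkDl -scaleN1r brkZl scaleN1r. Qed.

Lemma brkBr x y y' : brk x (y - y') = brk x y - brk x y'.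
Proof. by rewrite brkDr -scaleN1r brkZr scaleN1r. Qed.

Lemma brk_suml (I : Type) (r : seq I) (F : I -> L) y :
  brk (\sum_(i <- r) F i) y = \sum_(i <- r) brk (F i) y.
Proof. exact: (big_morph (brk^~ y) (fun u v => brkDl u v y) (brk0l y)). Qed.

Lemma brk_sumr (I : Type) (r : seq I) (F : I -> L) x :
  brk x (\sum_(i <- r) F i) = \sum_(i <- r) brk x (F i).
Proof. exact: (big_morph (brk x) (brkDr x) (brk0r x)). Qed.

End BracketTheory.

Lemma linear_fun_sum (V : lmodType rat) (g : V -> V) (I : Type) (r : seq I) (F : I -> V) :
  linear g -> g (\sum_(i <- r) F i) = \sum_(i <- r) g (F i).
Proof.
move=> hg; have gD x y : g (x + y) = g x + g y.
  by have := hg 1 x y; rewrite !scale1r.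
have g0 : g 0 = 0 by apply/(addrI (g 0)); rewrite -gD !addr0.
exact: (big_morph g gD g0).
Qed.

Definition homog_sum_of (V : lmodType rat) (h : int -> V -> Prop) (x : V) :=
  exists (s : seq int) (f : int -> V),
    [/\ uniq s, forall n, h n (f n) & x = \sum_(n <- s) f n].

Lemma homog_sum_ofD (V : lmodType rat) (h : int -> V -> Prop)
    (hlin : forall n (a : rat) x y, h n x -> h n y -> h n (a *: x + y))
    (h0 : forall n, h n 0) x y :
  homog_sum_of h x -> homog_sum_of h y -> homog_sum_of h (x + y).
Proof.
case=> s [f [us hf ->]] [t [g [ut hg ->]]].
exists (undup (s ++ t)).
exists (fun n => (if n \in s then f n else 0) + (if n \in t then g n else 0)).
split; first exact: undup_uniq.
  move=> n; rewrite -[X in X + _]scale1r; apply: hlin; by case: ifP.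
rewrite big_split !sum_restrict ?undup_uniq // => n nst.
  by rewrite mem_undup mem_cat nst orbT.
by rewrite mem_undup mem_cat nst.
Qed.

(* Homogeneous vectors of distinct degrees are eigenvectors with distinct
   eigenvalues of the automorphism multiplying degree n by 2 ^ n. *)
Lemma indep_eigen (V : lmodType rat) (h : int -> V -> Prop) (t : {linear V -> V})
    (ht : forall n x, h n x -> t x = (2 : rat) ^ n *: x)
    (hZ : forall n (a : rat) x, h n x -> h n (a *: x)) (s : seq int) (f : int -> V) :
  uniq s -> (forall n, h n (f n)) -> \sum_(n <- s) f n = 0 ->
  forall n, n \in s -> f n = 0.
Proof.
elim: s f => [|m s IHs] f //= /andP[ms us] hf e0.
have fs n : n \in s -> f n = 0.
  move=> ns; have: ((2 : rat) ^ n - 2 ^ m) *: f n = 0.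
    apply: (IHs (fun n => ((2 : rat) ^ n - 2 ^ m) *: f n)) => //.
      by move=> k; apply: hZ.
    have e1 : t (\sum_(k <- m :: s) f k) - (2 : rat) ^ m *: \sum_(k <- m :: s) f k = 0.
      by rewrite e0 linear0 scaler0 subrr.
    rewrite -[RHS]e1 linear_sum scaler_sumr -sumrB big_cons.
    rewrite (ht _ _ (hf m)) subrr add0r; apply: eq_bigr => k _.
    by rewrite (ht _ _ (hf k)) scalerBl.
  move/eqP; rewrite scaler_eq0 subr_eq0 => /orP[/eqP/ieexprIz nm|/eqP //].
  by move: ms; rewrite -(nm _ _) ?ns.
move=> n; rewrite inE => /orP[/eqP ->|/fs //].
by move: e0; rewrite big_cons big_seq big1 ?addr0.
Qed.

Section Cycles.
Variable L : dglType.

Definition cycle_pred : {pred L} := fun z => diff z == 0.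

Fact cycle_submod : submod_closed cycle_pred.
Proof.
split=> [|a x y]; rewrite !unfold_in ?linear0 // => /eqP dx /eqP dy.
by rewrite linearP dx dy scaler0 addr0.
Qed.
HB.instance Definition _ := GRing.isSubmodClosed.Build rat L cycle_pred cycle_submod.

Record cycle := Cycle { cycle_val :> L; cycleP : cycle_val \in cycle_pred }.
HB.instance Definition _ := [isSub for cycle_val].
HB.instance Definition _ := [Choice of cycle by <:].
HB.instance Definition _ := [SubChoice_isSubLmodule of cycle by <:].

Lemma diff_cycle (z : cycle) : diff (z : L) = 0.
Proof. by apply/eqP; exact: cycleP z. Qed.

Lemma cycle_val_sum (s : seq int) (f : int -> cycle) :
  (\sum_(n <- s) f n : cycle) = \sum_(n <- s) (f n : L) :> L.
Proof. exact: (big_morph cycle_val). Qed.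

Definition homologous (z w : cycle) : bool := `[< exists y : L, z - w = diff y :> L >].

Lemma homologousP (z w : cycle) : reflect (exists y : L, z - w = diff y :> L) (homologous z w).
Proof. exact: asboolP. Qed.

Fact homologous_refl : reflexive homologous.
Proof. by move=> z; apply/homologousP; exists 0; rewrite subrr linear0. Qed.

Fact homologous_sym : symmetric homologous.
Proof.
by move=> z w; apply/homologousP/homologousP => -[y e]; exists (- y);
  rewrite linearN -e opprB.
Qed.

Fact homologous_trans : transitive homologous.
Proof.
move=> w z u /homologousP[y e] /homologousP[y' e']; apply/homologousP.
by exists (y + y'); rewrite linearD -e -e' addrA subrK.
Qed.

Definition homologous_equiv :=
  EquivRel homologous homologous_refl homologous_sym homologous_trans.

Definition homology := {eq_quot homologous_equiv}.
HB.instance Definition _ := Choice.on homology.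
HB.instance Definition _ := EqQuotient.on homology.

Definition cls (z : cycle) : homology := \pi_homology z.

Lemma clsP (z w : cycle) : reflect (exists y : L, z - w = diff y :> L) (cls z == cls w).
Proof. rewrite /cls eqmodE; exact: homologousP. Qed.

Lemma clsE (z w : cycle) (y : L) : z - w = diff y :> L -> cls z = cls w.
Proof. by move=> e; apply/eqP/clsP; exists y. Qed.

Lemma homology_ind (P : homology -> Prop) : (forall z, P (cls z)) -> forall h, P h.
Proof. by move=> Pc h; rewrite -[h]reprK; apply: Pc. Qed.

Lemma repr_cls (z : cycle) : exists y : L, (repr (cls z) : cycle) - z = diff y :> L.
Proof. by apply/clsP; rewrite /cls reprK. Qed.

Definition hadd (a b : homology) : homology := cls (repr a + repr b).
Definition hopp (a : homology) : homology := cls (- repr a).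
Definition hscale (c : rat) (a : homology) : homology := cls (c *: repr a).

Lemma haddE z w : hadd (cls z) (cls w) = cls (z + w).
Proof.
have [y e] := repr_cls z; have [y' e'] := repr_cls w.
by apply: (@clsE _ _ (y + y')); rewrite [RHS]linearD -e -e' /= opprD addrACA.
Qed.

Lemma hoppE z : hopp (cls z) = cls (- z).
Proof.
have [y e] := repr_cls z.
by apply: (@clsE _ _ (- y)); rewrite [RHS]linearN -e /= opprK opprB addrC.
Qed.

Lemma hscaleE c z : hscale c (cls z) = cls (c *: z).
Proof.
have [y e] := repr_cls z.
by apply: (@clsE _ _ (c *: y)); rewrite [RHS]linearZ /= -e /= scalerBr.
Qed.

Fact haddA : associative hadd.
Proof.
elim/homology_ind=> x; elim/homology_ind=> y; elim/homology_ind=> z.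
by rewrite !haddE addrA.
Qed.
Fact haddC : commutative hadd.
Proof. by elim/homology_ind=> x; elim/homology_ind=> y; rewrite !haddE addrC. Qed.
Fact hadd0 : left_id (cls 0) hadd.
Proof. by elim/homology_ind=> x; rewrite haddE add0r. Qed.
Fact haddN : left_inverse (cls 0) hopp hadd.
Proof. by elim/homology_ind=> x; rewrite hoppE haddE addNr. Qed.

HB.instance Definition _ := GRing.isZmodule.Build homology haddA haddC hadd0 haddN.

Fact hscaleA a b v : hscale a (hscale b v) = hscale (a * b) v.
Proof. by elim/homology_ind: v => z; rewrite !hscaleE scalerA. Qed.
Fact hscale1 : left_id 1 hscale.
Proof. by elim/homology_ind=> z; rewrite hscaleE scale1r. Qed.
Fact hscaleDr : right_distributive hscale +%R.
Proof.
move=> a; elim/homology_ind=> x; elim/homology_ind=> y.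
by rewrite /GRing.add /= !(haddE, hscaleE) scalerDr.
Qed.
Fact hscaleDl v : {morph hscale^~ v : a b / a + b}.
Proof.
elim/homology_ind: v => z a b.
by rewrite [in RHS]/GRing.add /= !(haddE, hscaleE) scalerDl.
Qed.

HB.instance Definition _ := GRing.Zmodule_isLmodule.Build rat homology
  hscaleA hscale1 hscaleDr hscaleDl.

Fact cls_linear : linear cls.
Proof.
move=> a x y; rewrite [a *: cls x]hscaleE.
by rewrite [RHS]haddE.
Qed.
HB.instance Definition _ :=
  GRing.isLinear.Build rat cycle homology _ cls cls_linear.

Lemma cls_eq0 (z : cycle) : reflect (exists y : L, z = diff y :> L) (cls z == 0).
Proof.
rewrite -(linear0 cls); apply: (iffP (clsP _ _)) => -[y e]; exists y.
  by rewrite -e /= subr0.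
by rewrite /= subr0.
Qed.

Definition hhomog (n : int) (h : homology) : Prop :=
  exists2 z : cycle, homog n (z : L) & cls z = h.

Fact hhomog_lin n (a : rat) x y : hhomog n x -> hhomog n y -> hhomog n (a *: x + y).
Proof.
case=> z hz <- [w hw <-]; exists (a *: z + w); last exact: linearP.
exact: homog_lin.
Qed.

Lemma cycle_components (s : seq int) (f : int -> L) : uniq s ->
  (forall n, homog n (f n)) -> diff (\sum_(n <- s) f n) = 0 ->
  forall n, n \in s -> diff (f n) = 0.
Proof.
move=> us hf; rewrite linear_sum => e n ns.
have := @homog_indep L [seq m - 1 | m <- s] (fun m => diff (f (m + 1))).
move=> /(_ _ _ _ (n - 1)); rewrite subrK; apply.
- by rewrite map_inj_uniq //; apply: addIr.
- by move=> m; rewrite -{1}[m](addrK 1); apply: diff_homog.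
- by rewrite big_map -[RHS]e; apply: eq_bigr => m _; rewrite subrK.
exact: (map_f (fun m : int => m - 1)) ns.
Qed.

Lemma cycle_decomp (z : cycle) : exists (s : seq int) (f : int -> cycle),
  [/\ uniq s, forall n, homog n (f n : L) & z = \sum_(n <- s) f n].
Proof.
have [s [f [us hf e]]] := homog_decomp (z : L).
have df n : n \in s -> diff (f n) = 0.
  by apply: cycle_components => //; rewrite -e diff_cycle.
have cf n : (if n \in s then f n else 0) \in cycle_pred.
  by case: ifP => [/df dfn|_]; rewrite unfold_in ?dfn ?linear0.
exists s, (fun n => Cycle (cf n)); split=> // [n|].
  by rewrite /=; case: ifP => // _; apply: homog0.
apply: val_inj; rewrite /= cycle_val_sum e.
by rewrite big_seq [RHS]big_seq; apply: eq_bigr => n /= ->.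
Qed.

Fact hhomog_decomp x : homog_sum_of hhomog x.
Proof.
elim/homology_ind: x => z; have [s [f [us hf ->]]] := cycle_decomp z.
exists s, (fun n => cls (f n)); split=> // [n|]; last exact: linear_sum.
by exists (f n).
Qed.

Fact hhomog_indep (s : seq int) (f : int -> homology) :
  uniq s -> (forall n, hhomog n (f n)) -> \sum_(n <- s) f n = 0 ->
  forall n, n \in s -> f n = 0.
Proof.
move=> us hf.
have [z hz] : {z : int -> cycle & forall n, homog n (z n : L) /\ cls (z n) = f n}.
  apply: (choice (P := fun n (w : cycle) => homog n (w : L) /\ cls w = f n)) => n.
  by have [w hw e] := hf n; exists w.
rewrite (eq_bigr (fun n => cls (z n))); last by move=> n _; have [] := hz n.
rewrite -linear_sum => /eqP/cls_eq0[y]; have [t [g [ut hg ey]]] := homog_decomp y.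
rewrite cycle_val_sum => e n ns; have [_ <-] := hz n.
pose r := undup ([seq m - 1 | m <- t] ++ s).
have sr : {subset s <= r} by move=> m ms; rewrite mem_undup mem_cat ms orbT.
have tr : {subset [seq m - 1 | m <- t] <= r}.
  by move=> m ms; rewrite mem_undup mem_cat ms.
have ut1 : uniq [seq m - 1 | m <- t] by rewrite map_inj_uniq //; apply: addIr.
pose dg m := diff (g (m + 1)).
have e1 : \sum_(m <- r) ((if m \in s then z m : L else 0)
    - (if m \in [seq k - 1 | k <- t] then dg m else 0)) = 0.
  rewrite sumrB !sum_restrict ?undup_uniq // e ey linear_sum big_map.
  by apply/eqP; rewrite subr_eq0; apply/eqP/eq_bigr => m _; rewrite /dg subrK.
apply/eqP/cls_eq0.
have := @homog_indep L r _ (undup_uniq _) _ e1 n (sr _ ns); rewrite ns => en.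
have {en} /eqP : (z n : L) - (if n \in [seq k - 1 | k <- t] then dg n else 0) = 0.
  apply: en => m; apply: homogB; case: ifP => _; try exact: homog0.
    by have [] := hz m.
  by rewrite -{1}[m](addrK 1); apply: diff_homog.
rewrite subr_eq0 => /eqP ->.
by case: ifP => _; [exists (g (n + 1))|exists 0; rewrite linear0].
Qed.

HB.instance Definition _ := isGraded.Build homology
  hhomog_lin hhomog_decomp hhomog_indep.

Fact brk_cycle (z w : cycle) : brk (z : L) (w : L) \in cycle_pred.
Proof.
have [s [f [_ hf ->]]] := cycle_decomp z.
rewrite unfold_in cycle_val_sum brk_suml linear_sum big1 //= => n _.
by rewrite (diff_brk _ _ _ (hf n)) !diff_cycle brk0l brk0r scaler0 addr0.
Qed.

Definition cycle_brk (z w : cycle) : cycle := Cycle (brk_cycle z w).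

Definition hbrk (a b : homology) : homology := cls (cycle_brk (repr a) (repr b)).

Lemma brk_boundaryl (y : L) (w : cycle) : brk (diff y) (w : L) = diff (brk y (w : L)).
Proof.
have [s [f [_ hf ->]]] := homog_decomp y.
rewrite !(linear_sum, brk_suml) /=; apply: eq_bigr => n _.
by rewrite (diff_brk _ _ _ (hf n)) diff_cycle brk0r scaler0 addr0.
Qed.

Lemma brk_boundaryr (z : cycle) (y : L) :
  exists u : L, brk (z : L) (diff y) = diff u.
Proof.
have [s [f [_ hf ->]]] := cycle_decomp z.
exists (\sum_(n <- s) (-1) ^ n *: brk (f n : L) y).
rewrite cycle_val_sum brk_suml linear_sum; apply: eq_bigr => n _.
rewrite linearZ /= (diff_brk _ _ _ (hf n)) diff_cycle brk0l add0r scalerA.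
by rewrite -exprMz_comm // mulrNN mulr1 exp1rz scale1r.
Qed.

Lemma hbrkE (z w : cycle) : hbrk (cls z) (cls w) = cls (cycle_brk z w).
Proof.
have [y e] := repr_cls z; have [y' e'] := repr_cls w.
have [u eu] := brk_boundaryr z y'.
rewrite /hbrk; apply: (@clsE _ _ (brk y (cycle_val (repr (cls w))) + u)).
rewrite [RHS]linearD /= -eu -brk_boundaryl -e -e' brkBl brkBr.
by rewrite addrA subrK.
Qed.

Fact hbrk_linl y : linear (hbrk^~ y).
Proof.
elim/homology_ind: y => y a; elim/homology_ind=> x; elim/homology_ind=> z.
rewrite -linearP !hbrkE -linearP; congr cls; apply: val_inj => /=.
exact: brk_linl.
Qed.

Fact hbrk_linr x : linear (hbrk x).
Proof.
elim/homology_ind: x => x a; elim/homology_ind=> y; elim/homology_ind=> z.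
rewrite -linearP !hbrkE -linearP; congr cls; apply: val_inj => /=.
exact: brk_linr.
Qed.

Fact hbrk_homog m n x y : hhomog m x -> hhomog n y -> hhomog (m + n) (hbrk x y).
Proof.
case=> z hz <- [w hw <-]; exists (cycle_brk z w); last by rewrite hbrkE.
exact: brk_homog.
Qed.

Fact hbrk_antisym m n x y : hhomog m x -> hhomog n y ->
  hbrk x y = - ((-1) ^ (m * n) *: hbrk y x).
Proof.
case=> z hz <- [w hw <-]; rewrite !hbrkE -linearZ -linearN /=; congr cls.
apply: val_inj; exact: brk_antisym.
Qed.

Fact hbrk_jacobi m n p x y z : hhomog m x -> hhomog n y -> hhomog p z ->
  hbrk x (hbrk y z) = hbrk (hbrk x y) z + (-1) ^ (m * n) *: hbrk y (hbrk x z).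
Proof.
case=> x' hx <- [y' hy <-] [z' hz <-]; rewrite !hbrkE -linearZ -linearD /=.
congr cls; apply: val_inj; exact: brk_jacobi hz.
Qed.

HB.instance Definition _ := hasBracket.Build homology
  hbrk_linl hbrk_linr hbrk_homog hbrk_antisym hbrk_jacobi.

End Cycles.

Definition represents (L : dglType) (z : L) (h : homology L) : Prop :=
  exists2 c : cycle L, cycle_val c = z & cls c = h.

Section FreeLie.
Variables (T : Type) (deg : T -> int).

Inductive lie_term : Type :=
| TGen of T
| TZero
| TAdd of lie_term & lie_term
| TScale of rat & lie_term
| TBrk of lie_term & lie_term.

Inductive term_homog : int -> lie_term -> Prop :=
| THGen t : term_homog (deg t) (TGen t)
| THZero n : term_homog n TZero
| THAdd n a b : term_homog n a -> term_homog n b -> term_homog n (TAdd a b)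
| THScale n c a : term_homog n a -> term_homog n (TScale c a)
| THBrk m n a b : term_homog m a -> term_homog n b -> term_homog (m + n) (TBrk a b).

Inductive lie_cong : lie_term -> lie_term -> Prop :=
| LCrefl a : lie_cong a a
| LCsym a b : lie_cong a b -> lie_cong b a
| LCtrans a b c : lie_cong a b -> lie_cong b c -> lie_cong a c
| LCadd a a' b b' : lie_cong a a' -> lie_cong b b' -> lie_cong (TAdd a b) (TAdd a' b')
| LCscale c a a' : lie_cong a a' -> lie_cong (TScale c a) (TScale c a')
| LCbrk a a' b b' : lie_cong a a' -> lie_cong b b' -> lie_cong (TBrk a b) (TBrk a' b')
| LCaddA a b c : lie_cong (TAdd a (TAdd b c)) (TAdd (TAdd a b) c)
| LCaddC a b : lie_cong (TAdd a b) (TAdd b a)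
| LCadd0 a : lie_cong (TAdd TZero a) a
| LCaddN a : lie_cong (TAdd (TScale (- 1) a) a) TZero
| LCscaleA c d a : lie_cong (TScale c (TScale d a)) (TScale (c * d) a)
| LCscale1 a : lie_cong (TScale 1 a) a
| LCscaleDr c a b : lie_cong (TScale c (TAdd a b)) (TAdd (TScale c a) (TScale c b))
| LCscaleDl c d a : lie_cong (TScale (c + d) a) (TAdd (TScale c a) (TScale d a))
| LCbrkl c a a' b :
    lie_cong (TBrk (TAdd (TScale c a) a') b) (TAdd (TScale c (TBrk a b)) (TBrk a' b))
| LCbrkr c a b b' :
    lie_cong (TBrk a (TAdd (TScale c b) b')) (TAdd (TScale c (TBrk a b)) (TBrk a b'))
| LCantisym m n a b : term_homog m a -> term_homog n b ->
    lie_cong (TBrk a b) (TScale (- 1) (TScale ((-1) ^ (m * n)) (TBrk b a)))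
| LCjacobi m n p a b c : term_homog m a -> term_homog n b -> term_homog p c ->
    lie_cong (TBrk a (TBrk b c))
      (TAdd (TBrk (TBrk a b) c) (TScale ((-1) ^ (m * n)) (TBrk b (TBrk a c)))).

HB.instance Definition _ := gen_eqMixin lie_term.
HB.instance Definition _ := gen_choiceMixin lie_term.

Definition lie_congb (a b : lie_term) : bool := `[< lie_cong a b >].

Fact lie_congb_refl : reflexive lie_congb.
Proof. by move=> a; apply/asboolP; apply: LCrefl. Qed.
Fact lie_congb_sym : symmetric lie_congb.
Proof. by move=> a b; apply/asboolP/asboolP; apply: LCsym. Qed.
Fact lie_congb_trans : transitive lie_congb.
Proof. by move=> b a c /asboolP ab /asboolP bc; apply/asboolP; apply: LCtrans bc. Qed.

Definition lie_equiv := EquivRel lie_congb lie_congb_refl lie_congb_sym lie_congb_trans.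

Definition freeLie := {eq_quot lie_equiv}.
HB.instance Definition _ := Choice.on freeLie.
HB.instance Definition _ := EqQuotient.on freeLie.

Definition tcls (a : lie_term) : freeLie := \pi_freeLie a.

Lemma tclsP a b : tcls a = tcls b <-> lie_cong a b.
Proof.
split=> [/eqP|ab]; first by rewrite /tcls eqmodE => /asboolP.
by apply/eqP; rewrite /tcls eqmodE; apply/asboolP.
Qed.

Lemma tclsE a b : lie_cong a b -> tcls a = tcls b.
Proof. by move/tclsP. Qed.

Lemma freeLie_quot (P : freeLie -> Prop) : (forall a, P (tcls a)) -> forall x, P x.
Proof. by move=> Pc x; rewrite -[x]reprK; apply: Pc. Qed.

Lemma repr_tcls a : lie_cong (repr (tcls a)) a.
Proof. by apply/tclsP; rewrite /tcls reprK. Qed.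

Definition fadd (x y : freeLie) : freeLie := tcls (TAdd (repr x) (repr y)).
Definition fscale (c : rat) (x : freeLie) : freeLie := tcls (TScale c (repr x)).
Definition fbrk (x y : freeLie) : freeLie := tcls (TBrk (repr x) (repr y)).

Lemma faddE a b : fadd (tcls a) (tcls b) = tcls (TAdd a b).
Proof. by apply/tclsE/LCadd; apply: repr_tcls. Qed.
Lemma fscaleE c a : fscale c (tcls a) = tcls (TScale c a).
Proof. by apply/tclsE/LCscale; apply: repr_tcls. Qed.
Lemma fbrkE a b : fbrk (tcls a) (tcls b) = tcls (TBrk a b).
Proof. by apply/tclsE/LCbrk; apply: repr_tcls. Qed.

Fact faddA : associative fadd.
Proof.
elim/freeLie_quot=> a; elim/freeLie_quot=> b; elim/freeLie_quot=> c.
by rewrite !faddE; apply/tclsE/LCaddA.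
Qed.
Fact faddC : commutative fadd.
Proof.
by elim/freeLie_quot=> a; elim/freeLie_quot=> b; rewrite !faddE; apply/tclsE/LCaddC.
Qed.
Fact fadd0 : left_id (tcls TZero) fadd.
Proof. by elim/freeLie_quot=> a; rewrite faddE; apply/tclsE/LCadd0. Qed.
Fact faddN : left_inverse (tcls TZero) (fscale (- 1)) fadd.
Proof. by elim/freeLie_quot=> a; rewrite fscaleE faddE; apply/tclsE/LCaddN. Qed.

HB.instance Definition _ := GRing.isZmodule.Build freeLie faddA faddC fadd0 faddN.

Fact fscaleA a b v : fscale a (fscale b v) = fscale (a * b) v.
Proof. by elim/freeLie_quot: v => z; rewrite !fscaleE; apply/tclsE/LCscaleA. Qed.
Fact fscale1 : left_id 1 fscale.
Proof. by elim/freeLie_quot=> z; rewrite fscaleE; apply/tclsE/LCscale1. Qed.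
Fact fscaleDr : right_distributive fscale +%R.
Proof.
move=> c; elim/freeLie_quot=> a; elim/freeLie_quot=> b.
by rewrite /GRing.add /= !(faddE, fscaleE); apply/tclsE/LCscaleDr.
Qed.
Fact fscaleDl v : {morph fscale^~ v : a b / a + b}.
Proof.
elim/freeLie_quot: v => z a b.
by rewrite [in RHS]/GRing.add /= !(faddE, fscaleE); apply/tclsE/LCscaleDl.
Qed.

HB.instance Definition _ := GRing.Zmodule_isLmodule.Build rat freeLie
  fscaleA fscale1 fscaleDr fscaleDl.

Lemma tclsD a b : tcls (TAdd a b) = tcls a + tcls b.
Proof. exact/esym/faddE. Qed.
Lemma tclsZ c a : tcls (TScale c a) = c *: tcls a.
Proof. exact/esym/fscaleE. Qed.
Lemma tcls0 : tcls TZero = 0.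
Proof. by []. Qed.

Definition fhomog (n : int) (x : freeLie) : Prop :=
  exists2 a, term_homog n a & tcls a = x.

Fact fhomog_lin n (c : rat) x y : fhomog n x -> fhomog n y -> fhomog n (c *: x + y).
Proof.
case=> a ha <- [b hb <-]; exists (TAdd (TScale c a) b); last by rewrite tclsD tclsZ.
by apply: THAdd => //; apply: THScale.
Qed.

Lemma fhomog0 n : fhomog n 0.
Proof. by exists TZero; first exact: THZero. Qed.

Lemma fhomogZ n c x : fhomog n x -> fhomog n (c *: x).
Proof. by move=> hx; rewrite -[_ *: _]addr0; apply: fhomog_lin => //; apply: fhomog0. Qed.

Fact fbrk_linl y : linear (fbrk^~ y).
Proof.
elim/freeLie_quot: y => b c; elim/freeLie_quot=> a; elim/freeLie_quot=> a' /=.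
rewrite -tclsZ -tclsD !fbrkE -tclsZ -tclsD; exact/tclsE/LCbrkl.
Qed.

Fact fbrk_linr x : linear (fbrk x).
Proof.
elim/freeLie_quot: x => a c; elim/freeLie_quot=> b; elim/freeLie_quot=> b' /=.
rewrite -tclsZ -tclsD !fbrkE -tclsZ -tclsD; exact/tclsE/LCbrkr.
Qed.

Fact fbrk_homog m n x y : fhomog m x -> fhomog n y -> fhomog (m + n) (fbrk x y).
Proof.
case=> a ha <- [b hb <-]; exists (TBrk a b); last by rewrite fbrkE.
exact: THBrk.
Qed.

Fact fhomog_decomp x : homog_sum_of fhomog x.
Proof.
have h1 n x' : fhomog n x' -> homog_sum_of fhomog x'.
  move=> hx; exists [:: n], (fun m => if m == n then x' else 0); split=> // [m|].
    by case: eqP => [->|_] //; apply: fhomog0.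
  by rewrite big_seq1 eqxx.
have hsum (I : Type) (r : seq I) (F : I -> freeLie) :
    (forall i, homog_sum_of fhomog (F i)) -> homog_sum_of fhomog (\sum_(i <- r) F i).
  move=> hF; elim/big_ind: _ => //; first exact: h1 (fhomog0 0).
  by apply: homog_sum_ofD; [exact: fhomog_lin|exact: fhomog0].
elim/freeLie_quot: x; elim=> [t||a IHa b IHb|c a [s [f [us hf ea]]]|a IHa b IHb].
- by apply: (h1 (deg t)); exists (TGen t); first exact: THGen.
- exact: h1 (fhomog0 0).
- by rewrite tclsD; apply: homog_sum_ofD => //; [exact: fhomog_lin|exact: fhomog0].
- exists s, (fun n => c *: f n); split=> // [n|]; first exact: fhomogZ.
  by rewrite tclsZ ea scaler_sumr.
- case: IHa => s [f [_ hf ea]]; case: IHb => t [g [_ hg eb]].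
  rewrite -fbrkE ea eb (linear_fun_sum _ _ (fbrk_linl _)).
  apply: (hsum) => m; rewrite (linear_fun_sum _ _ (fbrk_linr _)); apply: (hsum) => n.
  by apply: (h1 (m + n)); apply: fbrk_homog.
Qed.

(* the endomorphism multiplying each generator t by c ^ deg t *)
Fixpoint term_dil (c : rat) (a : lie_term) : lie_term :=
  match a with
  | TGen t => TScale (c ^ deg t) (TGen t)
  | TZero => TZero
  | TAdd a b => TAdd (term_dil c a) (term_dil c b)
  | TScale e a => TScale e (term_dil c a)
  | TBrk a b => TBrk (term_dil c a) (term_dil c b)
  end.

Lemma term_dil_homog c n a : term_homog n a -> term_homog n (term_dil c a).
Proof.
elim=> /= *; [exact/THScale/THGen|exact: THZero|exact: THAdd|exact: THScale|
              exact: THBrk].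
Qed.

Lemma term_dil_cong c a b : lie_cong a b -> lie_cong (term_dil c a) (term_dil c b).
Proof.
elim=> /=.
all: try by constructor.
- by move=> *; apply: LCtrans; eassumption.
- by move=> m n x y hx hy; apply: LCantisym; apply: term_dil_homog.
- move=> m n p x y z hx hy hz.
  by apply: (@LCjacobi m n p); apply: term_dil_homog.
Qed.

Lemma tcls_brk a b : tcls (TBrk a b) = fbrk (tcls a) (tcls b).
Proof. by rewrite fbrkE. Qed.

Lemma linear_funZ (g : freeLie -> freeLie) : linear g -> forall c x, g (c *: x) = c *: g x.
Proof.
move=> hg c x; have g0 : g 0 = 0.
  by have := @linear_fun_sum _ g void [::] (fun _ => 0) hg; rewrite !big_nil.
by have := hg c x 0; rewrite g0 !addr0.
Qed.

Lemma tcls_dil c n a : c != 0 -> term_homog n a ->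
  tcls (term_dil c a) = c ^ n *: tcls a.
Proof.
move=> c0; elim=> /= {n a}.
- by move=> t; rewrite tclsZ.
- by move=> n; rewrite tcls0 scaler0.
- by move=> n a b _ ea _ eb; rewrite !tclsD ea eb scalerDr.
- by move=> n e a _ ea; rewrite !tclsZ ea !scalerA mulrC.
move=> m n a b _ ea _ eb; rewrite !tcls_brk ea eb.
rewrite (linear_funZ (fbrk_linl _)) (linear_funZ (fbrk_linr _)) scalerA.
by rewrite expfzDr.
Qed.

Definition dil (c : rat) (x : freeLie) : freeLie := tcls (term_dil c (repr x)).

Lemma dilE c a : dil c (tcls a) = tcls (term_dil c a).
Proof. by apply/tclsE/term_dil_cong/repr_tcls. Qed.

Fact dil_linear c : linear (dil c).
Proof.
move=> e; elim/freeLie_quot=> a; elim/freeLie_quot=> b.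
by rewrite -tclsZ -tclsD !dilE /= tclsD tclsZ.
Qed.
HB.instance Definition _ c :=
  GRing.isLinear.Build rat freeLie freeLie _ (dil c) (dil_linear c).

Lemma dil_homog c n x : c != 0 -> fhomog n x -> dil c x = c ^ n *: x.
Proof. by move=> c0 [a ha <-]; rewrite dilE (tcls_dil c0 ha). Qed.

Fact fhomog_indep (s : seq int) (f : int -> freeLie) :
  uniq s -> (forall n, fhomog n (f n)) -> \sum_(n <- s) f n = 0 ->
  forall n, n \in s -> f n = 0.
Proof.
apply: (indep_eigen (t := dil 2)) => [n x hx|n c x hx]; last exact: fhomogZ.
exact: dil_homog.
Qed.

HB.instance Definition _ := isGraded.Build freeLie fhomog_lin fhomog_decomp fhomog_indep.

Fact fbrk_antisym m n x y : fhomog m x -> fhomog n y ->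
  fbrk x y = - ((-1) ^ (m * n) *: fbrk y x).
Proof.
case=> a ha <- [b hb <-]; rewrite !fbrkE -tclsZ -scaleN1r -tclsZ.
exact/tclsE/LCantisym.
Qed.

Fact fbrk_jacobi m n p x y z : fhomog m x -> fhomog n y -> fhomog p z ->
  fbrk x (fbrk y z) = fbrk (fbrk x y) z + (-1) ^ (m * n) *: fbrk y (fbrk x z).
Proof.
case=> a ha <- [b hb <-] [c hc <-]; rewrite !fbrkE -tclsZ -tclsD.
exact/tclsE/(LCjacobi ha hb hc).
Qed.

HB.instance Definition _ := hasBracket.Build freeLie
  fbrk_linl fbrk_linr fbrk_homog fbrk_antisym fbrk_jacobi.

Definition fgen (t : T) : freeLie := tcls (TGen t).

Lemma fgen_homog t : homog (deg t) (fgen t).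
Proof. by exists (TGen t); first exact: THGen. Qed.

Section Derivation.
Variable del : T -> freeLie.
Hypothesis del_homog : forall t, homog (deg t - 1) (del t).

(* [dil (-1) x] is (-1) ^ n *: x for x homogeneous of degree n *)
Fixpoint term_der (a : lie_term) : freeLie :=
  match a with
  | TGen t => del t
  | TZero => 0
  | TAdd a b => term_der a + term_der b
  | TScale e a => e *: term_der a
  | TBrk a b => brk (term_der a) (tcls b) + brk (dil (-1) (tcls a)) (term_der b)
  end.

Lemma term_der_homog n a : term_homog n a -> homog (n - 1) (term_der a).
Proof.
elim=> {n a} /=.
- exact: del_homog.
- by move=> n; apply: homog0.
- by move=> *; apply: homogD.
- by move=> *; apply: homogZ.
move=> m n a b ha da hb db; apply: homogD.
  by rewrite addrAC; apply: brk_homog => //; exists b.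
rewrite -addrA; apply: brk_homog => //.
have ma : fhomog m (tcls a) by exists a.
by rewrite (dil_homog _ ma) //; apply: homogZ.
Qed.

Lemma sign_cases (m : int) : (-1 : rat) ^ m = 1 \/ (-1 : rat) ^ m = -1.
Proof.
have h (n : nat) : (-1 : rat) ^+ n = 1 \/ (-1 : rat) ^+ n = -1.
  by rewrite -signr_odd; case: odd; [right|left].
case: m => n; first exact: h.
by rewrite NegzE -exprnN; case: (h n.+1) => ->; [left; rewrite invr1|right; rewrite invrN1].
Qed.

Lemma term_der_cong a b : lie_cong a b -> term_der a = term_der b.
Proof.
have brkE x y : tcls (TBrk x y) = brk (tcls x) (tcls y) by rewrite tcls_brk.
elim=> {a b} /=.
- by [].
- by [].
- by move=> a b c _ -> _ ->.
- by move=> a a' b b' _ -> _ ->.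
- by move=> c a a' _ ->.
- by move=> a a' b b' /tclsE-> -> /tclsE-> ->.
- by move=> *; rewrite addrA.
- by move=> *; rewrite addrC.
- by move=> *; rewrite add0r.
- by move=> a; rewrite scaleN1r addNr.
- by move=> *; rewrite scalerA.
- by move=> *; rewrite scale1r.
- by move=> *; rewrite scalerDr.
- by move=> *; rewrite scalerDl.
- move=> c a a' b; rewrite tclsD tclsZ linearP !(brkDl, brkZl) scalerDr.
  by rewrite -!addrA; congr (_ + _); rewrite addrCA.
- move=> c a b b'; rewrite tclsD tclsZ !(brkDr, brkZr) scalerDr.
  by rewrite -!addrA; congr (_ + _); rewrite addrCA.
- move=> m n a b ha hb.
  have ma : homog m (tcls a) by exists a.
  have nb : homog n (tcls b) by exists b.
  have da := term_der_homog ha; have db := term_der_homog hb.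
  rewrite (dil_homog _ ma) // (dil_homog _ nb) // !brkZl.
  rewrite (brk_antisym _ _ _ _ da nb) (brk_antisym _ _ _ _ ma db).
  rewrite !mulrBl !mulrBr !mul1r !mulr1 !expfzDr // -!invr_expz.
  by case: (sign_cases (m * n)) => ->; case: (sign_cases m) => ->;
    case: (sign_cases n) => ->; rewrite addrC;
    rewrite !(invrN1, divr1, mulrNN, mul1r, scaleN1r, scale1r, opprK, opprD).
move=> m n p a b c ha hb hc.
have ma : homog m (tcls a) by exists a.
have nb : homog n (tcls b) by exists b.
have pc : homog p (tcls c) by exists c.
have da := term_der_homog ha; have db := term_der_homog hb.
have dc := term_der_homog hc.
rewrite !brkE (dil_homog _ ma) // (dil_homog _ nb) //.
rewrite (dil_homog _ (brk_homog _ _ _ _ ma nb)) //.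
rewrite !(brkZl, brkZr, brkDr, brkDl).
rewrite (brk_jacobi _ _ _ _ _ _ da nb pc) (brk_jacobi _ _ _ _ _ _ ma db pc).
rewrite (brk_jacobi _ _ _ _ _ _ ma nb dc).
rewrite !mulrBl !mulrBr !mul1r !mulr1 !expfzDr // -!invr_expz !scalerDr !scalerA.
rewrite [LHS](AC (2*(2*2)) (1*3*5*(4*(2*6)))).
have dN x : x = 1 \/ x = -1 -> x^-1 = x :> rat by case=> ->; rewrite ?invr1 ?invrN1.
have s2 := sign_cases; have sq k : (-1 : rat) ^ k * (-1) ^ k = 1.
  by case: (s2 k) => ->; rewrite ?mulrNN mulr1.
congr (_ + (_ *: _ + (_ *: _ + _ *: _))).
- by rewrite dN // mulrCA sq mulr1.
- by rewrite dN.
by rewrite [RHS]mulrC [in RHS](mulrC _ (_ ^ m)).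
Qed.

Definition fder (x : freeLie) : freeLie := term_der (repr x).

Lemma fderE a : fder (tcls a) = term_der a.
Proof. exact/term_der_cong/repr_tcls. Qed.

Fact fder_linear : linear fder.
Proof.
move=> e; elim/freeLie_quot=> a; elim/freeLie_quot=> b.
by rewrite -tclsZ -tclsD !fderE.
Qed.

Lemma fder_gen t : fder (fgen t) = del t.
Proof. exact: fderE. Qed.

Lemma fder_homog n x : homog n x -> homog (n - 1) (fder x).
Proof. by case=> a ha <-; rewrite fderE; apply: term_der_homog. Qed.

Lemma fder_brk m x y : homog m x ->
  fder (brk x y) = brk (fder x) y + (-1) ^ m *: brk x (fder y).
Proof.
move=> hx; have e := dil_homog _ hx; case: hx => a ha ea; move: e; rewrite -{}ea => e.
elim/freeLie_quot: y => b; rewrite {1}/brk /= fbrkE !fderE /= e //.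
by rewrite brkZl.
Qed.
End Derivation.
End FreeLie.

(* Koszul sign of v_0 ... v_(m-1) |-> v_(s 0) ... v_(s (m-1)), |v_a| = d a *)
Definition koszul (m : nat) (d : 'I_m -> int) (s : 'S_m) : rat :=
  \prod_(a < m) \prod_(b < m | (a < b)%N && (s b < s a)%N) (-1) ^ (d (s a) * d (s b)).

(* (p, m - p)-shuffles s with s 0 = 0 *)
Definition shuffle1 (m p : nat) (s : 'S_m) : bool :=
  [forall a : 'I_m, forall b : 'I_m,
     (a < b)%N && ((b < p)%N || (p <= a)%N) ==> (s a < s b)%N]
  && [forall a : 'I_m, (a == 0 :> nat) ==> (s a == 0 :> nat)].

Section WhiteheadModel.
Variables (k : nat) (n : 'I_k -> int).

(* u_(i_1 ... i_s) is indexed by the set I = {i_1 < ... < i_s};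
   i_(a+1) is then [enum_val a] for a : 'I_#|I|. *)
Definition wh_index := {I : {set 'I_k} | (0 < #|I| < k)%N}.

Definition set_deg (I : {set 'I_k}) : int := \sum_(i in I) n i - 1.

Definition wh_deg (I : wh_index) : int := set_deg (val I).

(* extended by 0 to the sets that do not index a generator *)
Definition wh_gen (I : {set 'I_k}) : freeLie wh_deg :=
  if insub I is Some J then fgen wh_deg J else 0.

Definition fst_block (I : {set 'I_k}) (p : nat) (s : 'S_#|I|) : {set 'I_k} :=
  [set enum_val (s a) | a : 'I_#|I| & (a < p)%N].

Definition snd_block (I : {set 'I_k}) (p : nat) (s : 'S_#|I|) : {set 'I_k} :=
  [set enum_val (s a) | a : 'I_#|I| & (p <= a)%N].

Definition wh_bdry (I : {set 'I_k}) : freeLie wh_deg :=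
  \sum_(1 <= p < #|I|) \sum_(s : 'S_#|I| | shuffle1 p s)
    ((-1) ^ set_deg (fst_block p s) * koszul (fun a => n (enum_val a)) s)
      *: brk (wh_gen (fst_block p s)) (wh_gen (snd_block p s)).

Lemma wh_gen_homog (I : {set 'I_k}) : homog (set_deg I) (wh_gen I).
Proof.
rewrite /wh_gen; case: insubP => [J _ <-|_]; last exact: homog0.
exact: fgen_homog.
Qed.

Lemma set_deg_blocks (I : {set 'I_k}) p (s : 'S_#|I|) :
  set_deg (fst_block p s) + set_deg (snd_block p s) = set_deg I - 1.
Proof.
have inj (A : {pred 'I_#|I|}) : {in A &, injective (fun a => @enum_val _ (mem I) (s a))}.
  by move=> a b _ _ /enum_val_inj/perm_inj.
rewrite /set_deg /fst_block /snd_block !big_imset /=; [|exact: inj|exact: inj].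
rewrite [X in _ = X - 1 - 1]big_enum_val /=.
rewrite [X in _ = X - 1 - 1](reindex_inj (@perm_inj _ s)) /=.
rewrite [X in _ = X - 1 - 1](bigID (fun a : 'I_#|I| => (a < p)%N)) /= addrACA -!addrA.
congr (_ + (_ + _)); apply: eq_bigl => a; rewrite inE //.
by rewrite leqNgt.
Qed.

Lemma wh_bdry_homog (I : {set 'I_k}) : homog (set_deg I - 1) (wh_bdry I).
Proof.
apply: homog_sum => p _; apply: homog_sum => s _; apply: homogZ.
by rewrite -(set_deg_blocks p s); apply: brk_homog; apply: wh_gen_homog.
Qed.

Definition wh_del (I : wh_index) : freeLie wh_deg := wh_bdry (val I).

Fact wh_del_homog I : homog (wh_deg I - 1) (wh_del I).
Proof. exact: wh_bdry_homog. Qed.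

Definition whLie := freeLie wh_deg.
HB.instance Definition _ := GradedLie.on whLie.

Definition wh_diff : whLie -> whLie := fder wh_del.
HB.instance Definition _ := GRing.isLinear.Build rat whLie whLie _ wh_diff
  (fder_linear wh_del_homog).

Fact wh_diff_homog m (x : whLie) : homog m x -> homog (m - 1) (wh_diff x).
Proof. exact: (fder_homog wh_del_homog). Qed.

Fact wh_diff_brk m (x y : whLie) : homog m x ->
  wh_diff (brk x y) = brk (wh_diff x) y + (-1) ^ m *: brk x (wh_diff y).
Proof. exact: (fder_brk wh_del_homog). Qed.

HB.instance Definition _ := hasDerivation.Build whLie wh_diff_homog wh_diff_brk.

Lemma diff_wh_gen (I : {set 'I_k}) : (0 < #|I| < k)%N ->
  diff (wh_gen I : whLie) = wh_bdry I.
Proof.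
move=> hI; rewrite /wh_gen insubT /=.
by rewrite [LHS](fder_gen wh_del_homog).
Qed.

Definition omega : whLie := wh_bdry [set: 'I_k].

End WhiteheadModel.

(* The classes x_j are homogeneous of degree d_j, which is supplied explicitly
   since a zero class does not determine its degree. *)
Definition whitehead (L : dglType) (k : nat) (d : k.-tuple int)
    (x : k.-tuple (homology L)) (h : homology L) : Prop :=
  let n := fun j : 'I_k => tnth d j + 1 in
  exists phi : {linear whLie n -> L},
    [/\ dgl_morphism phi,
        forall j, represents (phi (wh_gen n [set j])) (tnth x j)
      & represents (phi (omega n)) h].

Record homotopy_retract (L : dglType) := HomotopyRetract {
  hr_i : {linear homology L -> L};
  hr_q : {linear L -> homology L};
  hr_K : {linear L -> L};
  hr_i_deg : graded_map 0 hr_i;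
  hr_q_deg : graded_map 0 hr_q;
  hr_K_deg : graded_map 1 hr_K;
  hr_i_chain : forall h, diff (hr_i h) = 0;
  hr_q_chain : forall x, hr_q (diff x) = 0;
  (* i induces the identity on homology; so it is a quasi-isomorphism *)
  hr_i_id : forall h, represents (hr_i h) h;
  hr_qi : forall h, hr_q (hr_i h) = h;
  hr_homotopy : forall x, x - hr_i (hr_q x) = diff (hr_K x) + hr_K (diff x)
}.

Inductive btree := Leaf | Node of btree & btree.

Fixpoint leaves (T : btree) : nat :=
  if T is Node l r then leaves l + leaves r else 1.

Fixpoint vertex (T : btree) : finType :=
  if T is Node l r then option (vertex l + vertex r)%type else unit.

(* [None] on the root *)
Fixpoint parent (T : btree) : vertex T -> option (vertex T) :=
  match T return vertex T -> option (vertex T) with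
  | Leaf => fun=> None
  | Node l r => fun v =>
      match v with
      | None => None
      | Some (inl w) => Some (omap inl (parent w))
      | Some (inr w) => Some (omap inr (parent w))
      end
  end.

(* [tree_isos T T] is the automorphism group of T as a non-planar rooted tree *)
Definition tree_isos (T T' : btree) : {set {ffun vertex T -> vertex T'}} :=
  [set f : {ffun vertex T -> vertex T'} |
    [&& injectiveb f, [forall w, w \in codom f]
      & [forall v, parent (f v) == omap f (parent v)]]].

Definition tree_iso (T T' : btree) : bool := tree_isos T T' != set0.

(* Ts contains exactly one plane drawing of each isomorphism class of binary
   rooted trees with k leaves *)
Definition plane_drawings (k : nat) (Ts : seq btree) : Prop :=
  [/\ all (fun T => leaves T == k) Ts,
      pairwise (fun T T' => ~~ tree_iso T T') Ts
    & forall T, leaves T = k -> has (tree_iso T) Ts].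

Section Transfer.
Variables (L : dglType) (R : homotopy_retract L).

Definition tree_branch (T : btree) (y : L) : L :=
  if T is Node _ _ then hr_K R y else y.

(* Value on v_1 (x) ... (x) v_k, for v the list of the pairs (|v_a|, v_a).
   A branch with r leaves contains r - 1 copies of K, which accounts for the
   sign of moving it past the inputs of the left branch. *)
Fixpoint tree_map (T : btree) (v : seq (int * homology L)) : L :=
  match T with
  | Leaf => hr_i R (head (0, 0) v).2
  | Node l r =>
      let a := take (leaves l) v in
      let b := drop (leaves l) v in
      ((-1) ^+ (leaves l - 1) * (-1) ^ ((leaves r - 1)%N%:Z * \sum_(e <- a) e.1))
        *: brk (tree_branch l (tree_map l a)) (tree_branch r (tree_map r b))
  end.

(* l_k (x_1, ..., x_k), k >= 2, for x_j homogeneous of degree d_j *)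
Definition transferred (k : nat) (Ts : seq btree) (d : k.-tuple int)
    (x : k.-tuple (homology L)) : homology L :=
  \sum_(T <- Ts) (#|tree_isos T T|%:R)^-1 *: hr_q R
    (\sum_(s : 'S_k) ((-1) ^+ s * koszul (tnth d) s)
        *: tree_map T [seq (tnth d (s a), tnth x (s a)) | a <- enum 'I_k]).

End Transfer.

(* Main.v *)
From HB Require Import structures.
Require Import Defs.
From mathcomp Require Import all_boot all_fingroup all_algebra generic_quotient.

Set Implicit Arguments.
Unset Strict Implicit.
Unset Printing Implicit Defensive.

Import GRing.Theory.
Local Open Scope ring_scope.

(** Shift all degrees by one: write n = |a| + 1 and a o b = (-1)^|a| [a, b].
    For the shifted degrees the operation o is graded commutative with the
    plain Koszul sign, diff is up to a global sign a derivation of o, and the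
    Jacobi identity becomes a three-term relation ([sbrkC], [diff_sbrk],
    [sbrk_jacobi]).  In this language both sides of the theorem are the same
    sum over binary trees whose four leaves are labelled by the x_j.

    On the Whitehead side, put y_j = i(x_j).  The boundary of u_I is the sum
    of the signed products u_A o u_B over the splittings of I in which A
    contains the least element ([wh_bdryE]).  If the value of phi on that
    boundary is itself a boundary, the homotopy gives a preimage: phi(u_I) is
    K of it.  Iterating, phi(u_I) becomes the sum of all binary trees with
    leaf set I, with K on their edges.  The obstruction vanishes for two
    indices because H is abelian.  For three indices it is the class of a
    triple bracket.  Changing the bounding elements of a triple bracket adds
    brackets of cycles, which are boundaries; replacing a cycle by a
    homologous one changes it by a boundary, by the Jacobi identity
    ([null_triple_homologous], [boundary_triple_bracket]).  So the obstruction
    does not depend on the choices, and the morphism given by nonemptiness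
    shows that it is zero.  Finally phi(omega) is a cycle ([diff_word_bdry])
    and q reads off its class.

    On the transferred side, rewriting the brackets of a tree with o produces
    a sign that depends on the word of inputs but not on the tree
    ([tree_map_value]).  It turns the signature times the Koszul sign of the
    degrees into the Koszul sign of the shifted degrees, up to the factor
    epsilon ([staircase_perm_words4]).  After this, all drawings of a labelled
    tree obtained by exchanging branches contribute equally, so the sum over
    S_4 counts each labelled tree of shape T exactly |Aut T| times
    ([canon_plant4]), and dividing by |Aut T| leaves phi(omega).

    All the signs depend only on the parities of four degrees, so identities
    between lists of signed words or signed trees are settled by evaluation. *)

(** * Automorphisms of binary trees *)

Definition troot (T : btree) : vertex T :=
  match T return vertex T with Leaf => tt | Node _ _ => None end.

Lemma parent_root T : parent (troot T) = None.
Proof. by case: T. Qed.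

Lemma parent_eq_None T (v : vertex T) : parent v = None -> v = troot T.
Proof. by case: T v => [[]|l r [[v|v]|]]. Qed.

(** Induction along [parent]: how a property of the root spreads over a tree,
    since an isomorphism is only known to commute with [parent]. *)
Lemma vertex_ind T (P : vertex T -> Prop) :
  P (troot T) -> (forall v u, parent v = Some u -> P u -> P v) -> forall v, P v.
Proof.
elim: T P => [|l IHl r IHr] P P0 PS; first by case.
have Pl v : P (Some (inl v)).
  elim/IHl: v => [|v u e Pu]; first by apply: (PS _ None); rewrite //= parent_root.
  by apply: (PS _ (Some (inl u))) => //=; rewrite e.
have Pr v : P (Some (inr v)).
  elim/IHr: v => [|v u e Pu]; first by apply: (PS _ None); rewrite //= parent_root.
  by apply: (PS _ (Some (inr u))) => //=; rewrite e.
by case=> [[v|v]|] //.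
Qed.

Lemma tree_isosP T T' (f : {ffun vertex T -> vertex T'}) :
  reflect [/\ injective f, (forall w, exists v, w = f v)
     & forall v, parent (f v) = omap f (parent v)] (f \in tree_isos T T').
Proof.
rewrite inE; apply: (iffP and3P) => [] [inj sur par]; split.
- exact/injectiveP.
- by move=> w; apply/codomP; apply: (forallP sur).
- by move=> v; apply/eqP; apply: (forallP par).
- exact/injectiveP.
- by apply/forallP => w; apply/codomP.
- by apply/forallP => v; apply/eqP.
Qed.

Lemma iso_root T T' (f : {ffun vertex T -> vertex T'}) :
  f \in tree_isos T T' -> f (troot T) = troot T'.
Proof.
by case/tree_isosP => _ _ par; apply: parent_eq_None; rewrite par parent_root.
Qed.

Definition glue l r l' r' (fg : {ffun vertex l -> vertex l'} * {ffun vertex r -> vertex r'}) :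
    {ffun vertex (Node l r) -> vertex (Node l' r')} :=
  [ffun v : vertex (Node l r) => match v return vertex (Node l' r') with
    | None => None
    | Some (inl u) => Some (inl (fg.1 u))
    | Some (inr u) => Some (inr (fg.2 u))
   end].

Definition swap l r (v : vertex (Node l r)) : vertex (Node r l) :=
  match v return vertex (Node r l) with
  | None => None
  | Some (inl u) => Some (inr u)
  | Some (inr u) => Some (inl u)
  end.

Lemma swapK l r : cancel (@swap l r) (@swap r l).
Proof. by case=> [[v|v]|]. Qed.

Lemma parent_swap l r (v : vertex (Node l r)) : parent (swap v) = omap (@swap l r) (parent v).
Proof. by case: v => [[v|v]|] //=; case: (parent v). Qed.

(** An isomorphism fixes the root, so it sends the two branches to the two
    branches.  These are the ones that do not exchange them; [swap] turns the
    others into isomorphisms of this kind. *)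
Definition left_isos l r l' r' : {set {ffun vertex (Node l r) -> vertex (Node l' r')}} :=
  [set f in tree_isos (Node l r) (Node l' r') |
    f (Some (inl (troot l))) == Some (inl (troot l'))].

Lemma in_left_isos l r l' r' (h : {ffun vertex (Node l r) -> vertex (Node l' r')}) :
  (h \in left_isos l r l' r') =
    (h \in tree_isos (Node l r) (Node l' r')) &&
      (h (Some (inl (troot l))) == Some (inl (troot l'))).
Proof. exact: in_set. Qed.

Lemma child_root l r (v : vertex (Node l r)) : parent v = Some None ->
  v = Some (inl (troot l)) \/ v = Some (inr (troot r)).
Proof.
case: v => [[v|v]|] //=; case e: (parent v) => [u|] //= _.
  by left; rewrite (parent_eq_None e).
by right; rewrite (parent_eq_None e).
Qed.

Lemma left_isos_glue l r l' r' :
  left_isos l r l' r' = @glue l r l' r' @: setX (tree_isos l l') (tree_isos r r').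
Proof.
apply/setP => h; apply/idP/imsetP => [|[[f g]]].
  rewrite in_left_isos => /andP[/[dup] hN /tree_isosP[inj sur par] /eqP hl].
  have h0 : h None = None by apply: (iso_root hN).
  (* [h] is injective, so the roots of the two branches have distinct images *)
  have hr : h (Some (inr (troot r))) = Some (inr (troot r')).
    have := par (Some (inr (troot r))).
    rewrite /= parent_root /= h0 => /child_root[] // e.
    by move: (inj _ _ (etrans e (esym hl))).
  have hL u : exists w, h (Some (inl u)) = Some (inl w).
    elim/vertex_ind: u => [|v u e [w hw]]; first by exists (troot l').
    have := par (Some (inl v)); rewrite /= e /= hw.
    case: (h _) => [[v'|v']|] //=; first by exists v'.
    by case: (parent v').
  have hR u : exists w, h (Some (inr u)) = Some (inr w).
    elim/vertex_ind: u => [|v u e [w hw]]; first by exists (troot r').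
    have := par (Some (inr v)); rewrite /= e /= hw.
    case: (h _) => [[v'|v']|] //=; last by exists v'.
    by case: (parent v').
  pose f := [ffun u => if h (Some (inl u)) is Some (inl w) then w else troot l'].
  pose g := [ffun u => if h (Some (inr u)) is Some (inr w) then w else troot r'].
  have fE u : h (Some (inl u)) = Some (inl (f u)) by rewrite ffunE; have [w ->] := hL u.
  have gE u : h (Some (inr u)) = Some (inr (g u)) by rewrite ffunE; have [w ->] := hR u.
  exists (f, g); last first.
    by apply/ffunP => -[[u|u]|]; rewrite ffunE.
  rewrite in_setX; apply/andP; split; apply/tree_isosP; split.
  - by move=> u v e; have := inj (Some (inl u)) (Some (inl v)); rewrite !fE e => /(_ erefl)[].
  - move=> w; have [[[v|v]|]] := sur (Some (inl w)); rewrite ?fE ?gE ?h0 //.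
    by case=> ->; exists v.
  - move=> v; have := par (Some (inl v)); rewrite /= fE /=.
    by case: (parent v) => [u|] /=; rewrite ?fE ?h0; case: (parent _) => //= u' [->].
  - by move=> u v e; have := inj (Some (inr u)) (Some (inr v)); rewrite !gE e => /(_ erefl)[].
  - move=> w; have [[[v|v]|]] := sur (Some (inr w)); rewrite ?fE ?gE ?h0 //.
    by case=> ->; exists v.
  - move=> v; have := par (Some (inr v)); rewrite /= gE /=.
    by case: (parent v) => [u|] /=; rewrite ?gE ?h0; case: (parent _) => //= u' [->].
rewrite in_setX /= => /andP[fI gI] ->.
have [injf surf parf] := tree_isosP _ fI; have [injg surg parg] := tree_isosP _ gI.
rewrite in_left_isos; apply/andP; split; last by rewrite ffunE /= (iso_root fI).
apply/tree_isosP; split.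
- move=> [[u|u]|] [[v|v]|]; rewrite !ffunE //= => -[].
    by move/injf ->.
  by move/injg ->.
- case=> [[w|w]|]; last by exists None; rewrite ffunE.
    by have [v ->] := surf w; exists (Some (inl v)); rewrite ffunE.
  by have [v ->] := surg w; exists (Some (inr v)); rewrite ffunE.
- case=> [[v|v]|]; rewrite !ffunE //=.
    by rewrite parf; case: (parent v) => [u|] /=; rewrite !ffunE.
  by rewrite parg; case: (parent v) => [u|] /=; rewrite !ffunE.
Qed.

Lemma card_left_isos l r l' r' :
  #|left_isos l r l' r'| = (#|tree_isos l l'| * #|tree_isos r r'|)%N.
Proof.
rewrite left_isos_glue card_imset ?cardsX // => -[f g] [f' g'] /ffunP e.
congr (_, _); apply/ffunP => u.
  by have := e (Some (inl u)); rewrite !ffunE => -[].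
by have := e (Some (inr u)); rewrite !ffunE => -[].
Qed.

(** The recursion behind the order of the automorphism group: either each
    branch keeps its side or both change sides. *)
Lemma card_tree_isos_Node l r l' r' :
  #|tree_isos (Node l r) (Node l' r')| =
    (#|tree_isos l l'| * #|tree_isos r r'| + #|tree_isos l r'| * #|tree_isos r l'|)%N.
Proof.
pose sw (f : {ffun vertex (Node l r) -> vertex (Node r' l')}) :=
  [ffun v => swap (f v)] : {ffun vertex (Node l r) -> vertex (Node l' r')}.
have swI : injective sw.
  move=> f g /ffunP e; apply/ffunP => v; have := e v; rewrite !ffunE.
  exact: (can_inj (@swapK _ _)).
rewrite -!card_left_isos -(card_imset _ swI) -cardsUI -[LHS]addn0.
congr (_ + _)%N; last first.
  apply/esym/eqP; rewrite cards_eq0; apply/eqP/setP => f; rewrite in_set0 in_setI in_left_isos.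
  apply/negP => /andP[/andP[_ /eqP e] /imsetP[g]].
  rewrite in_left_isos => /andP[_ /eqP e'] ef; move: e.
  by rewrite ef ffunE e'.
apply: eq_card => f; rewrite in_setU in_left_isos.
case: (boolP (f \in tree_isos _ _)) => [fI|/negP fI]; rewrite ?andTb ?andFb; last first.
  apply/esym/negP => /imsetP[g]; rewrite in_left_isos => /andP[/tree_isosP[inj sur par] _] ef.
  apply: fI; rewrite ef; apply/tree_isosP; split.
  - by move=> u v; rewrite !ffunE => /(can_inj (@swapK _ _))/inj.
  - move=> w; have [v e] := sur (swap w); exists v.
    by rewrite ffunE -e swapK.
  - by move=> v; rewrite !ffunE parent_swap par; case: (parent v) => //= u; rewrite ffunE.
case: eqP => //= hl; apply/esym/imsetP.
have [inj sur par] := tree_isosP _ fI.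
exists [ffun v => swap (f v)]; last by apply/ffunP => v; rewrite !ffunE swapK.
rewrite in_left_isos; apply/andP; split.
  apply/tree_isosP; split.
  - by move=> u v; rewrite !ffunE => /(can_inj (@swapK _ _))/inj.
  - move=> w; have [v e] := sur (swap w); exists v.
    by rewrite ffunE -e swapK.
  - by move=> v; rewrite !ffunE parent_swap par; case: (parent v) => //= u; rewrite ffunE.
rewrite ffunE.
have := par (Some (inl (troot l))); rewrite /= parent_root /=.
have -> : f None = None by apply: (iso_root fI).
by case/child_root => e; rewrite e //; case: hl.
Qed.

Lemma card_tree_isos_Leaf : #|tree_isos Leaf Leaf| = 1%N.
Proof.
pose f0 : {ffun vertex Leaf -> vertex Leaf} := [ffun _ => tt].
rewrite (_ : tree_isos _ _ = [set f0]) ?cards1 //.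
apply/setP => f; rewrite in_set1; apply/tree_isosP/eqP => [_|->].
  by apply/ffunP => v; rewrite ffunE; case: (f v).
split; first by case=> -[].
  by case; exists tt; case: (f0 tt).
by case; case: (f0 tt).
Qed.

Lemma card_tree_isos_LN l r : #|tree_isos Leaf (Node l r)| = 0%N.
Proof.
apply/eqP; rewrite cards_eq0; apply/eqP/setP => f; rewrite in_set0; apply/negP.
by case/tree_isosP => _ /(_ (Some (inl (troot l))))[[] e] /(_ tt); rewrite -e.
Qed.

Lemma card_tree_isos_NL l r : #|tree_isos (Node l r) Leaf| = 0%N.
Proof.
apply/eqP; rewrite cards_eq0; apply/eqP/setP => f; rewrite in_set0; apply/negP.
case/tree_isosP => inj _ _.
by have := inj None (Some (inl (troot l))); do 2![case: (f _)] => /(_ erefl).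
Qed.

Definition card_tree_isosE :=
  (card_tree_isos_Leaf, card_tree_isos_LN, card_tree_isos_NL, card_tree_isos_Node).

Lemma tree_isoE T T' : tree_iso T T' = (0 < #|tree_isos T T'|)%N.
Proof. by rewrite /tree_iso card_gt0. Qed.

Definition is_balanced (T : btree) : bool :=
  if T is Node (Node _ _) (Node _ _) then true else false.

Definition four_leaf_trees : seq btree :=
  let C := Node Leaf Leaf in
  [:: Node C C; Node (Node C Leaf) Leaf; Node (Node Leaf C) Leaf;
      Node Leaf (Node C Leaf); Node Leaf (Node Leaf C)].

Lemma leaves_Node l r : leaves (Node l r) = (leaves l + leaves r)%N.
Proof. by []. Qed.

Lemma leaves_gt0 T : (0 < leaves T)%N.
Proof. by elim: T => // l hl r _; rewrite leaves_Node ltn_addr. Qed.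

Lemma four_leaf_treesP T : leaves T = 4%N ->
  exists2 i, (i < 5)%N & T = nth Leaf four_leaf_trees i.
Proof.
have l1 U : leaves U = 1%N -> U = Leaf.
  case: U => [|l r]; rewrite ?leaves_Node //; have := leaves_gt0 l; have := leaves_gt0 r.
  by case: (leaves l) (leaves r) => [|[|?]] [|?].
have l2 U : leaves U = 2%N -> U = Node Leaf Leaf.
  case: U => [|l r]; rewrite ?leaves_Node //; have := leaves_gt0 l; have := leaves_gt0 r.
  case el: (leaves l) => [|[|n]] //; case er: (leaves r) => [|[|m]] // _ _.
  - by rewrite (l1 _ el) (l1 _ er).
  - by rewrite !(addSn, addnS).
  - by rewrite !(addSn, addnS).
have l3 U : leaves U = 3%N -> U = Node (Node Leaf Leaf) Leaf \/ U = Node Leaf (Node Leaf Leaf).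
  case: U => [|l r]; rewrite ?leaves_Node //.
  have := leaves_gt0 l; have := leaves_gt0 r.
  case el: (leaves l) => [|[|[|n]]] //; case er: (leaves r) => [|[|[|m]]] // _ _.
  - by right; rewrite (l1 _ el) (l2 _ er).
  - by left; rewrite (l2 _ el) (l1 _ er).
  all: try by rewrite !(addSn, addnS).
case: T => [|l r]; rewrite ?leaves_Node //.
have := leaves_gt0 l; have := leaves_gt0 r.
case el: (leaves l) => [|[|[|[|n]]]] //; case er: (leaves r) => [|[|[|[|m]]]] // _ _.
all: try by rewrite !(addSn, addnS).
- by rewrite (l1 _ el); case: (l3 _ er) => ->; [exists 3%N|exists 4%N].
- by rewrite (l2 _ el) (l2 _ er); exists 0%N.
- by rewrite (l1 _ er); case: (l3 _ el) => ->; [exists 1%N|exists 2%N].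
Qed.

Lemma card_tree_isos4 T T' : leaves T = 4%N -> leaves T' = 4%N ->
  #|tree_isos T T'| =
    (if is_balanced T == is_balanced T' then if is_balanced T then 8 else 2 else 0)%N.
Proof.
case/four_leaf_treesP => i hi -> /four_leaf_treesP[j hj ->].
by case: i hi => [|[|[|[|[|//]]]]] _; case: j hj => [|[|[|[|[|//]]]]] _;
  cbn [nth four_leaf_trees]; rewrite !card_tree_isosE.
Qed.

(** There are two shapes of binary trees with four leaves, and a system of
    plane drawings contains exactly one tree of each. *)
Lemma sum_plane_drawings4 (V : nmodType) (F : bool -> V) Ts : plane_drawings 4 Ts ->
  \sum_(T <- Ts) F (is_balanced T) = F true + F false.
Proof.
case=> lTs pTs hTs.
have iso4 T T' : leaves T = 4%N -> leaves T' = 4%N ->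
    tree_iso T T' = (is_balanced T == is_balanced T').
  move=> hT hT'; rewrite tree_isoE card_tree_isos4 //.
  by case: eqP => // _; case: ifP.
have hb b : b \in map is_balanced Ts.
  have [T lT <-] : exists2 T, leaves T = 4%N & is_balanced T = b.
    case: b; [by exists (Node (Node Leaf Leaf) (Node Leaf Leaf))|].
    by exists (Node (Node (Node Leaf Leaf) Leaf) Leaf).
  move: (hTs T lT) lTs; elim: Ts {pTs hTs} => //= T' Ts IH.
  rewrite inE; case/orP => [h /andP[/eqP lT' _]|h /andP[_ /(IH h)->]]; last by rewrite orbT.
  by move: h; rewrite iso4 // => /eqP ->; rewrite eqxx.
have uTs : uniq (map is_balanced Ts).
  elim: Ts lTs pTs {hTs hb} => //= T Ts IH /andP[/eqP lT lTs] /andP[aT /(IH lTs) ->].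
  rewrite andbT; elim: Ts lTs aT {IH} => //= T' Ts IH /andP[/eqP lT' lTs] /andP[nT /(IH lTs) h].
  by rewrite inE negb_or h andbT -iso4.
rewrite -(big_map is_balanced xpredT F) (perm_big [:: true; false]).
  by rewrite big_cons big_seq1.
by apply: uniq_perm => // b; rewrite hb; case: b.
Qed.

(** * Signs and parities *)

Definition sgn (b : bool) : rat := (-1) ^+ b.

Lemma sgnD a b : sgn (a (+) b) = sgn a * sgn b.
Proof. by rewrite /sgn signr_addb. Qed.

Lemma sgn_mul a : sgn a * sgn a = 1.
Proof. by rewrite -sgnD addbb. Qed.

Lemma sgnN a : sgn (~~ a) = - sgn a.
Proof. by rewrite -addTb sgnD /sgn expr1 mulN1r. Qed.

Definition oddz (m : int) : bool := odd `|m|%N.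

Lemma expN1z (m : int) : (-1 : rat) ^ m = sgn (oddz m).
Proof.
rewrite /sgn /oddz signr_odd; case: m => n //.
by rewrite NegzE abszN absz_nat -exprnN -exprVn invrN1.
Qed.

Lemma oddzD m n : oddz (m + n) = oddz m (+) oddz n.
Proof.
have e (a b : bool) : sgn a = sgn b -> a = b by case: a b => -[].
by apply: e; rewrite sgnD -!expN1z expfzDr.
Qed.

Lemma oddzM m n : oddz (m * n) = oddz m && oddz n.
Proof. by rewrite /oddz abszM oddM. Qed.

Lemma oddzN m : oddz (- m) = oddz m.
Proof. by rewrite /oddz abszN. Qed.

(** * Permutations as words *)

Definition perm_word m (s : 'S_m) : seq nat := [seq val (s a) | a <- enum 'I_m].

Lemma size_perm_word m (s : 'S_m) : size (perm_word s) = m.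
Proof. by rewrite size_map size_enum_ord. Qed.

Lemma nth_perm_word m (s : 'S_m) (a : 'I_m) : nth 0%N (perm_word s) a = s a.
Proof. by rewrite (nth_map a) ?size_enum_ord // nth_ord_enum. Qed.

(** The words of all permutations of m letters, with their signatures, built
    from the choice of the first letter [j]: moving [j] to the front crosses
    the [j] smaller letters, and [bump j] renames the remaining ones. *)
Fixpoint perm_words (m : nat) : seq (bool * seq nat) :=
  if m is m'.+1 then
    [seq (odd j (+) w.1, j :: map (bump j) w.2) | j <- iota 0 m, w <- perm_words m']
  else [:: (false, [::])].

Lemma perm_word_lift m (j : 'I_m.+1) (s : 'S_m) :
  perm_word (lift_perm ord0 j s) = (j : nat) :: map (bump j) (perm_word s).
Proof.
rewrite /perm_word enum_ordSl /= lift_perm_id -!map_comp; congr (_ :: _).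
by apply: eq_map => a /=; rewrite lift_perm_lift.
Qed.

Lemma sum_perm_words (V : nmodType) m (F : bool -> seq nat -> V) :
  \sum_(s : 'S_m) F (odd_perm s) (perm_word s) = \sum_(w <- perm_words m) F w.1 w.2.
Proof.
elim: m F => [|m IHm] F.
  rewrite big_seq1 (big_pred1 1%g) => [|s] /=; last first.
    by apply/esym/eqP/permP => -[].
  by rewrite odd_perm1; congr (F _ _); rewrite /perm_word enum_ord0.
rewrite big_allpairs_dep -[iota 0 _]/(index_iota 0 m.+1) big_mkord.
(* an injection between sets of cardinality (m + 1)! *)
have bij : bijective (fun js : 'I_m.+1 * 'S_m => lift_perm ord0 js.1 js.2).
  apply: inj_card_bij; last by rewrite card_prod !card_Sn card_ord.
  move=> [j s] [j' s'] /= e; have ej : j = j'.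
    by have := congr1 (fun t : 'S_m.+1 => t ord0) e; rewrite !lift_perm_id.
  rewrite -{j'}ej in e *; congr (_, _); apply/permP => a; apply: (@lift_inj _ j).
  by rewrite -!(lift_perm_lift ord0) e.
rewrite (reindex _ (onW_bij _ bij)) -(pair_bigA _ (fun j s =>
  F (lift_perm ord0 j s) (perm_word (lift_perm ord0 j s)))) /=.
apply: eq_bigr => j _.
rewrite -[RHS](IHm (fun b w => F (odd j (+) b) ((j : nat) :: map (bump j) w))).
by apply: eq_bigr => s _; rewrite odd_lift_perm perm_word_lift.
Qed.

Section Inversions.
Variable e : nat -> bool.

Definition parity (w : seq nat) : bool := foldr (fun i b => e i (+) b) false w.

Lemma parityE w : parity w = \big[addb/false]_(i <- w) e i.
Proof. by elim: w => [|i w IH] /=; rewrite ?big_nil // big_cons -IH. Qed.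

Lemma parity_cat u v : parity (u ++ v) = parity u (+) parity v.
Proof. by rewrite !parityE big_cat. Qed.

Lemma parity_perm u v : perm_eq u v -> parity u = parity v.
Proof. by move=> h; rewrite !parityE (perm_big _ h). Qed.

(** Exponent of the Koszul sign: the number, modulo 2, of inversions of the
    word between letters of odd degree. *)
Fixpoint inv_parity (w : seq nat) : bool :=
  if w is i :: w' then
    foldr (fun j b => ((j < i)%N && (e i && e j)) (+) b) (inv_parity w') w'
  else false.

Lemma inv_parity_cons i w :
  inv_parity (i :: w) =
    foldr (fun j b => ((j < i)%N && (e i && e j)) (+) b) false w (+) inv_parity w.
Proof.
by rewrite /=; elim: w (inv_parity w) => [|j w IH] b //=; rewrite IH addbA.
Qed.

Lemma sgn_inv_parity w : sgn (inv_parity w) =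
  \prod_(a < size w) \prod_(b < size w | (a < b)%N && (nth 0%N w b < nth 0%N w a)%N)
     sgn (e (nth 0%N w a) && e (nth 0%N w b)).
Proof.
elim: w => [|i w IHw]; first by rewrite big_ord0.
rewrite inv_parity_cons sgnD IHw big_ord_recl /=; congr (_ * _).
  rewrite big_mkcond big_ord_recl /= mul1r -big_mkcond /=.
  transitivity (\prod_(j <- w | (j < i)%N) sgn (e i && e j)); last first.
    by rewrite (big_nth 0%N) big_mkord.
  elim: {IHw} w => [|j w IH] /=; first by rewrite big_nil.
  by rewrite big_cons sgnD IH; case: ifP => // _; rewrite mul1r.
apply: eq_bigr => a _; rewrite [RHS]big_mkcond big_ord_recl /= mul1r -big_mkcond.
by [].
Qed.

End Inversions.

Lemma koszul_word m (d : 'I_m -> int) (e : nat -> bool) (s : 'S_m) :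
  (forall a, e (val a) = oddz (d a)) -> koszul d s = sgn (inv_parity e (perm_word s)).
Proof.
move=> he; rewrite sgn_inv_parity size_perm_word; apply: eq_bigr => a _.
apply: eq_big => [b|b _]; first by rewrite !nth_perm_word.
by rewrite !nth_perm_word expN1z oddzM -!he.
Qed.

Lemma inv_parity_map (e e' : nat -> bool) (f : nat -> nat) w :
  {in w &, {mono f : i j / (i < j)%N}} -> {in w, forall i, e (f i) = e' i} ->
  inv_parity e [seq f i | i <- w] = inv_parity e' w.
Proof.
elim: w => // i w IH hf he; rewrite map_cons !inv_parity_cons IH; first last.
- by move=> j jw; apply: he; rewrite inE jw orbT.
- by move=> j k jw kw; apply: hf; rewrite inE ?jw ?kw orbT.
congr (_ (+) _); have hi : i \in i :: w by rewrite inE eqxx.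
have : {subset w <= i :: w} by move=> j jw; rewrite inE jw orbT.
elim: {1 3 4}w => //= j w' IH' sw; rewrite IH'; last by move=> k kw; apply: sw; rewrite inE kw orbT.
have hj : j \in i :: w by apply: sw; rewrite inE eqxx.
by rewrite hf // !he.
Qed.

(** * Shuffles as splittings of a word *)

Fixpoint divisions (w : seq nat) : seq (seq nat * seq nat) :=
  if w is i :: w' then
    [seq (i :: AB.1, AB.2) | AB <- divisions w'] ++ [seq (AB.1, i :: AB.2) | AB <- divisions w']
  else [:: ([::], [::])].

(** A shuffle fixing the first letter is the same as a division of the word
    into two nonempty subwords, the first of which keeps the first letter. *)
Definition splits (w : seq nat) : seq (seq nat * seq nat) :=
  if w is i :: w' then [seq (i :: AB.1, AB.2) | AB <- divisions w' & AB.2 != [::]] else [::].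

Lemma divisions_map (f : nat -> nat) w :
  divisions (map f w) = [seq (map f AB.1, map f AB.2) | AB <- divisions w].
Proof. by elim: w => //= i w ->; rewrite map_cat -!map_comp. Qed.

Lemma splits_map (f : nat -> nat) w :
  splits (map f w) = [seq (map f AB.1, map f AB.2) | AB <- splits w].
Proof.
case: w => //= i w; rewrite divisions_map filter_map -!map_comp.
rewrite (eq_filter (a2 := fun AB => AB.2 != [::])) //.
by case=> A [].
Qed.

Lemma divisionsP w A B : (A, B) \in divisions w ->
  [/\ subseq A w, subseq B w & perm_eq (A ++ B) w].
Proof.
elim: w A B => [|i w IH] A B /=; first by rewrite inE => /eqP[-> ->].
rewrite mem_cat => /orP[] /mapP[[A' B'] /IH[hA hB hAB] [-> ->]] /=.
  split; rewrite ?eqxx //; last by rewrite perm_cons.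
  exact: subseq_trans hB (subseq_cons _ _).
split; rewrite ?eqxx //; first exact: subseq_trans hA (subseq_cons _ _).
by rewrite -cat1s perm_catCA /= perm_cons.
Qed.

Lemma splitsP w A B : (A, B) \in splits w ->
  [/\ A != [::], B != [::], subseq A w, subseq B w & perm_eq (A ++ B) w].
Proof.
case: w => //= i w /mapP[[A' B']]; rewrite mem_filter.
case/andP=> /= hB0 /divisionsP[hA hB hAB] [-> ->].
split=> //; first by rewrite /= eqxx.
  exact: subseq_trans hB (subseq_cons _ _).
by rewrite perm_cons.
Qed.

Lemma splits_size w A B : (A, B) \in splits w ->
  [/\ (0 < size A)%N, (0 < size B)%N, (size A < size w)%N & (size B < size w)%N].
Proof.
move=> /splitsP[hA hB _ _ /perm_size]; rewrite size_cat => <-.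
rewrite -!size_eq0 -!lt0n in hA hB; split=> //.
  by rewrite -[X in (X < _)%N]addn0 ltn_add2l.
by rewrite -[X in (X < _)%N]add0n ltn_add2r.
Qed.

(** [shuffle1] read on the word of the permutation, in a form that evaluates. *)
Definition shuffle_word m p (w : seq nat) : bool :=
  all (fun a => all (fun b =>
     (a < b)%N && ((b < p)%N || (p <= a)%N) ==> (nth 0 w a < nth 0 w b)%N) (iota 0 m)) (iota 0 m)
  && all (fun a => (a == 0%N) ==> (nth 0 w a == 0)%N) (iota 0 m).

Lemma shuffle1_word m p (s : 'S_m) : shuffle1 p s = shuffle_word m p (perm_word s).
Proof.
have allI (P : pred nat) (Q : pred 'I_m) : (forall a : 'I_m, Q a = P a) ->
    [forall a, Q a] = all P (iota 0 m).
  move=> PQ; apply/forallP/allP => [h a|h a].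
    by rewrite mem_iota /= add0n => am; rewrite -(PQ (Ordinal am)).
  by rewrite PQ; apply: h; rewrite mem_iota /= add0n ltn_ord.
congr (_ && _); apply: (allI) => a; last by rewrite nth_perm_word.
by apply: (allI) => b; rewrite !nth_perm_word.
Qed.

(** Concatenating the two parts of a splitting yields the word of the shuffle;
    the bijection is checked by listing both sides. *)
Lemma sum_shuffles (V : nmodType) m (G : nat -> seq nat -> V) : (m <= 4)%N ->
  \sum_(1 <= p < m) \sum_(s : 'S_m | shuffle1 p s) G p (perm_word s)
    = \sum_(AB <- splits (iota 0 m)) G (size AB.1) (AB.1 ++ AB.2).
Proof.
pose pws := [seq (p, w.2) | p <- iota 1 (m - 1), w <- perm_words m].
move=> hm; transitivity
  (\sum_(pw <- [seq pw <- pws | shuffle_word m pw.1 pw.2]) G pw.1 pw.2).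
  rewrite [RHS]big_filter [RHS]big_mkcond [RHS]big_allpairs_dep /=; apply: eq_bigr => p _.
  rewrite -(sum_perm_words m (fun _ w => if shuffle_word m p w then G p w else 0)).
  by rewrite -big_mkcond; apply: eq_bigl => s; rewrite shuffle1_word.
rewrite -(big_map (fun AB => (size AB.1, AB.1 ++ AB.2)) xpredT (fun pw => G pw.1 pw.2)).
apply: perm_big; rewrite {}/pws; move: m hm => [|[|[|[|[|//]]]]] _; by vm_compute.
Qed.

Section WordsSets.
Variable k : nat.
Implicit Types (I : {set 'I_k}) (w : seq nat).

(** Subsets of {0, ..., k - 1} are handled as increasing words, on which
    splittings and signs evaluate. *)
Definition set_of (w : seq nat) : {set 'I_k} := [set x | val x \in w].
Definition elts (I : {set 'I_k}) : seq nat := [seq val x | x <- enum I].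

Lemma mem_elts I (x : 'I_k) : (val x \in elts I) = (x \in I).
Proof. by rewrite mem_map ?mem_enum //; apply: val_inj. Qed.

Lemma set_of_elts I : set_of (elts I) = I.
Proof. by apply/setP => x; rewrite inE mem_elts. Qed.

Lemma eltsE I : elts I = [seq i <- iota 0 k | i \in elts I].
Proof.
rewrite -val_enum_ord filter_map; congr (map _ _).
rewrite {1}enumT; apply: eq_filter => x /=.
by rewrite mem_elts.
Qed.

Lemma elts_subseq I : subseq (elts I) (iota 0 k).
Proof. by rewrite eltsE filter_subseq. Qed.

Lemma elts_set_of w : subseq w (iota 0 k) -> elts (set_of w) = w.
Proof.
move=> sw; rewrite eltsE [RHS](subseq_uniqP _ sw) ?iota_uniq //.
apply: eq_in_filter => i; rewrite mem_iota /= add0n => ik.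
by rewrite -[i]/(val (Ordinal ik)) mem_elts inE.
Qed.

Lemma uniq_elts I : uniq (elts I).
Proof. by rewrite map_inj_uniq ?enum_uniq //; apply: val_inj. Qed.

Lemma size_elts I : size (elts I) = #|I|.
Proof. by rewrite size_map -cardE. Qed.

Lemma nth_elts I (a : 'I_#|I|) : nth 0%N (elts I) a = val (enum_val a).
Proof.
by rewrite (nth_map (enum_val a)) -?cardE ?ltn_ord // -(enum_val_nth (enum_val a)).
Qed.

Lemma nth_elts_mono I : {in iota 0 #|I| &, {mono nth 0%N (elts I) : i j / (i < j)%N}}.
Proof.
move=> i j; rewrite !mem_iota /= !add0n => hi hj.
have so : sorted ltn (elts I).
  by rewrite eltsE; apply: sorted_filter (iota_ltn_sorted _ _); apply: ltn_trans.
have lt a b : (a < b)%N -> (b < #|I|)%N -> (nth 0%N (elts I) a < nth 0%N (elts I) b)%N.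
  move=> ab bI; apply: (sorted_ltn_nth ltn_trans) => //; rewrite inE size_elts //.
  exact: ltn_trans bI.
case: (ltngtP i j) => [ij|ji|->]; last by rewrite ltnn.
  exact: lt.
by apply/negbTE; rewrite -leqNgt ltnW // lt.
Qed.

Variables (n : 'I_k -> int) (e : nat -> bool).
Hypothesis he : forall j : 'I_k, e (val j) = oddz (n j).

(** The generator u_I has degree one less than the sum of the n_i, hence the
    negation. *)
Lemma oddz_set_deg w : uniq w -> {subset w <= iota 0 k} ->
  oddz (set_deg n (set_of w)) = ~~ parity e w.
Proof.
move=> uw sw; rewrite /set_deg oddzD addbT; congr (~~ _).
have pw : perm_eq (elts (set_of w)) w.
  apply: uniq_perm (uniq_elts _) uw _ => i; rewrite eltsE mem_filter.
  case: (boolP (i \in iota 0 k)) => hi; last first.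
    by rewrite andbF; apply/esym/negP => /sw; apply/negP.
  have ik : (i < k)%N by rewrite mem_iota in hi.
  by rewrite andbT -[i]/(val (Ordinal ik)) mem_elts inE.
rewrite parityE -(perm_big _ pw) big_map -big_enum.
rewrite (big_morph oddz (id1 := false) (op1 := addb)) //; last exact: oddzD.
by apply: eq_bigr => i _; rewrite he.
Qed.

Lemma set_of_block I (Q : pred nat) (s : 'S_#|I|) (u : seq nat) :
  (forall i, i \in u <-> exists2 a : 'I_#|I|, Q a & i = s a) ->
  [set enum_val (s a) | a : 'I_#|I| & Q a] = set_of (map (nth 0%N (elts I)) u).
Proof.
move=> hu; apply/setP => x; rewrite [RHS]inE; apply/imsetP/mapP => [[a]|[i]].
  rewrite inE => Qa ->; exists (val (s a)); last by rewrite nth_elts.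
  by apply/hu; exists a.
move=> /hu[a Qa ->] ex; exists a; first by rewrite inE.
by apply: val_inj; rewrite [LHS]ex nth_elts.
Qed.

Lemma mem_take_perm_word m p (s : 'S_m) i :
  i \in take p (perm_word s) <-> exists2 a : 'I_m, (a < p)%N & i = s a.
Proof.
split=> [/(nthP 0%N)[a]|[a ap ->]].
  rewrite size_take_min size_perm_word leq_min => /andP[ap am] <-.
  by exists (Ordinal am); rewrite // nth_take // (nth_perm_word s (Ordinal am)).
rewrite -nth_perm_word -(nth_take 0%N ap) mem_nth //.
by rewrite size_take_min size_perm_word leq_min ap ltn_ord.
Qed.

Lemma mem_drop_perm_word m p (s : 'S_m) i :
  i \in drop p (perm_word s) <-> exists2 a : 'I_m, (p <= a)%N & i = s a.
Proof.
split=> [/(nthP 0%N)[a]|[a ap ->]].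
  rewrite size_drop size_perm_word ltn_subRL => am <-.
  exists (Ordinal am); first exact: leq_addr.
  by rewrite nth_drop (nth_perm_word s (Ordinal am)).
rewrite -nth_perm_word -{1}(subnKC ap) -nth_drop mem_nth //.
by rewrite size_drop size_perm_word ltn_sub2r // (leq_ltn_trans ap).
Qed.

Lemma perm_word_perm m (s : 'S_m) : perm_eq (perm_word s) (iota 0 m).
Proof.
apply: uniq_perm; rewrite ?iota_uniq //.
  by rewrite map_inj_uniq ?enum_uniq // => a b /val_inj/perm_inj.
move=> i; rewrite mem_iota /= add0n; apply/mapP/idP => [[a _ ->]|im]; first exact: ltn_ord.
by exists ((s^-1)%g (Ordinal im)); rewrite ?mem_enum // permKV.
Qed.

(** The differential of the Whitehead model as a sum over splittings.  The sign
    of the degree of the first block is kept apart: it is the one absorbed by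
    the shifted bracket. *)
Lemma wh_bdryE I : (#|I| <= 4)%N ->
  wh_bdry n I = \sum_(AB <- splits (elts I))
    (sgn (~~ parity e AB.1) * sgn (inv_parity e (AB.1 ++ AB.2)))
      *: brk (wh_gen n (set_of AB.1)) (wh_gen n (set_of AB.2)).
Proof.
move=> hI; pose f := nth 0%N (elts I).
have ew : elts I = map f (iota 0 #|I|).
  by rewrite -size_elts map_nth_iota0 // take_size.
pose G p w := (sgn (~~ parity e (map f (take p w))) * sgn (inv_parity e (map f w)))
  *: brk (wh_gen n (set_of (map f (take p w)))) (wh_gen n (set_of (map f (drop p w)))).
rewrite ew splits_map big_map /=.
transitivity (\sum_(AB <- splits (iota 0 #|I|)) G (size AB.1) (AB.1 ++ AB.2)); last first.
  apply: eq_bigr => -[A B] _; rewrite /G /=.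
  by rewrite take_size_cat // drop_size_cat // map_cat.
rewrite -sum_shuffles //; apply: eq_bigr => p _; apply: eq_bigr => s _.
rewrite /G.
have -> : fst_block p s = set_of (map f (take p (perm_word s))).
  exact: (@set_of_block _ (fun a => a < p)%N _ _ (mem_take_perm_word p s)).
have -> : snd_block p s = set_of (map f (drop p (perm_word s))).
  exact: (@set_of_block _ (fun a => p <= a)%N _ _ (mem_drop_perm_word p s)).
have sI : {subset perm_word s <= iota 0 #|I|} by move=> i; rewrite (perm_mem (perm_word_perm s)).
congr ((_ * _) *: _).
  rewrite expN1z oddz_set_deg //.
    rewrite map_inj_in_uniq ?take_uniq ?(perm_uniq (perm_word_perm s)) ?iota_uniq //.
    move=> i j /mem_take/sI hi /mem_take/sI hj eij.
    by have := nth_elts_mono hi hj; have := nth_elts_mono hj hi; rewrite -/f eij ltnn; case: ltngtP.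
  move=> i /mapP[j /mem_take/sI hj ->]; apply: (mem_subseq (elts_subseq I)).
  by rewrite mem_nth // size_elts; rewrite mem_iota in hj.
rewrite (@koszul_word _ _ (fun a => e (f a))) => [|a]; last by rewrite -he /f nth_elts.
congr sgn; apply/esym/inv_parity_map => // i j /sI hi /sI hj.
exact: nth_elts_mono.
Qed.

End WordsSets.

(** * Morphisms out of a free graded Lie algebra *)

Section FreeExtension.
Variables (T : Type) (deg : T -> int) (L : gradedLieType) (f : T -> L).
Hypothesis hf : forall t, homog (deg t) (f t).

Fixpoint term_ev (a : lie_term T) : L :=
  match a with
  | TGen t => f t
  | TZero => 0
  | TAdd a b => term_ev a + term_ev b
  | TScale c a => c *: term_ev a
  | TBrk a b => brk (term_ev a) (term_ev b)
  end.

Lemma term_ev_homog n a : term_homog deg n a -> homog n (term_ev a).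
Proof.
elim=> {n a} /= *; [exact: hf|exact: homog0|exact: homogD|exact: homogZ|exact: brk_homog].
Qed.

Lemma term_ev_cong a b : lie_cong deg a b -> term_ev a = term_ev b.
Proof.
elim=> {a b} /=.
- by [].
- by [].
- by move=> a b c _ -> _ ->.
- by move=> a a' b b' _ -> _ ->.
- by move=> c a a' _ ->.
- by move=> a a' b b' _ -> _ ->.
- by move=> *; rewrite addrA.
- by move=> *; rewrite addrC.
- by move=> *; rewrite add0r.
- by move=> a; rewrite scaleN1r addNr.
- by move=> *; rewrite scalerA.
- by move=> *; rewrite scale1r.
- by move=> *; rewrite scalerDr.
- by move=> *; rewrite scalerDl.
- by move=> *; rewrite brkDl brkZl.
- by move=> *; rewrite brkDr brkZr.
- move=> m n a b /term_ev_homog ha /term_ev_homog hb.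
  by rewrite (brk_antisym _ _ _ _ ha hb) scaleN1r.
move=> m n p a b c /term_ev_homog ha /term_ev_homog hb /term_ev_homog hc.
exact: brk_jacobi hc.
Qed.

Definition free_ev (x : freeLie deg) : L := term_ev (repr x).

Lemma free_evE a : free_ev (tcls deg a) = term_ev a.
Proof. exact/term_ev_cong/repr_tcls. Qed.

Fact free_ev_linear : linear free_ev.
Proof.
move=> c; elim/freeLie_quot=> a; elim/freeLie_quot=> b.
by rewrite -tclsZ -tclsD !free_evE.
Qed.

Definition free_ext : {linear freeLie deg -> L} :=
  HB.pack free_ev (GRing.isLinear.Build rat (freeLie deg) L _ free_ev free_ev_linear).

Lemma free_ext_gen t : free_ext (fgen deg t) = f t.
Proof. exact: free_evE. Qed.

Lemma free_ext_brk x y : free_ext (brk x y) = brk (free_ext x) (free_ext y).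
Proof.
elim/freeLie_quot: x => a; elim/freeLie_quot: y => b.
by rewrite /free_ext /= {1}/brk /= fbrkE !free_evE.
Qed.

Lemma free_ext_homog : graded_map 0 free_ext.
Proof.
by move=> n x [a ha <-]; rewrite addr0 /free_ext /= free_evE; apply: term_ev_homog.
Qed.

End FreeExtension.

Section WhiteheadMorphism.
Variables (k : nat) (n : 'I_k -> int) (L : diffLieType) (phi : {linear whLie n -> L}).
Hypothesis phi_brk : forall x y, phi (brk x y) = brk (phi x) (phi y).
Hypothesis phi_homog : graded_map 0 phi.
Hypothesis phi_gen : forall I, phi (wh_bdry n (val I)) = diff (phi (fgen (wh_deg n) I)).

(** Commuting with the differential need only be checked on the generators.
    The Leibniz rule has a sign depending on the degree of the left factor, so
    that factor is first decomposed into homogeneous components. *)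
Lemma wh_morphism_diff (x : whLie n) : phi (diff x) = diff (phi x).
Proof.
elim/freeLie_quot: x; elim=> [I||a IHa b IHb|c a IHa|a IHa b IHb].
- rewrite -[tcls _ _]/(fgen (wh_deg n) I) -phi_gen; congr (phi _).
  exact: (fder_gen (wh_del_homog n)).
- by rewrite tcls0 !linear0.
- by rewrite tclsD !linearD /= IHa IHb.
- by rewrite tclsZ !linearZ /= IHa.
rewrite -fbrkE -[fbrk _ _]/(brk (tcls (wh_deg n) a : whLie n) (tcls (wh_deg n) b)).
move: (tcls _ a : whLie n) (tcls _ b : whLie n) IHa IHb => x y hx hy.
have [s [g [us hg ex]]] := homog_decomp x.
rewrite phi_brk {1 2}ex !(linear_sum, brk_suml) /=.
transitivity (brk (phi (diff x)) (phi y) +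
    \sum_(m <- s) (-1) ^ m *: brk (phi (g m)) (diff (phi y))).
  rewrite ex !(linear_sum, brk_suml) -big_split /=; apply: eq_bigr => m _.
  by rewrite (diff_brk _ _ _ (hg m)) linearD linearZ /= !phi_brk hy.
rewrite hx ex !(linear_sum, brk_suml) -big_split /=; apply: eq_bigr => m _.
by have := phi_homog (hg m); rewrite addr0 => /diff_brk ->.
Qed.

End WhiteheadMorphism.

(** * The shifted bracket *)

Section ShiftedBracket.
Variable L : diffLieType.
Implicit Types x y z : L.

(** [b] is the parity of the degree plus one. *)
Definition shifted_parity (b : bool) x : Prop := exists2 m, homog m x & oddz m = ~~ b.

(** The operation (-1)^|x| [x, y], where [b] stands for the parity of |x| + 1.
    Its shift by one makes the bracket graded commutative, with all signs
    governed by the shifted degrees alone. *)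
Definition sbrk (b : bool) x y : L := sgn (~~ b) *: brk x y.

Lemma sbrkDl b x x' y : sbrk b (x + x') y = sbrk b x y + sbrk b x' y.
Proof. by rewrite /sbrk brkDl scalerDr. Qed.

Lemma sbrkDr b x y y' : sbrk b x (y + y') = sbrk b x y + sbrk b x y'.
Proof. by rewrite /sbrk brkDr scalerDr. Qed.

Lemma sbrkZl b a x y : sbrk b (a *: x) y = a *: sbrk b x y.
Proof. by rewrite /sbrk brkZl !scalerA mulrC. Qed.

Lemma sbrkZr b a x y : sbrk b x (a *: y) = a *: sbrk b x y.
Proof. by rewrite /sbrk brkZr !scalerA mulrC. Qed.

Lemma sbrkNl b x y : sbrk b (- x) y = - sbrk b x y.
Proof. by rewrite -!scaleN1r sbrkZl. Qed.

Lemma sbrkNr b x y : sbrk b x (- y) = - sbrk b x y.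
Proof. by rewrite -!scaleN1r sbrkZr. Qed.

Lemma sbrk_suml b (I : Type) (r : seq I) (F : I -> L) y :
  sbrk b (\sum_(i <- r) F i) y = \sum_(i <- r) sbrk b (F i) y.
Proof. by rewrite /sbrk brk_suml scaler_sumr. Qed.

Lemma sbrk_sumr b (I : Type) (r : seq I) (F : I -> L) x :
  sbrk b x (\sum_(i <- r) F i) = \sum_(i <- r) sbrk b x (F i).
Proof. by rewrite /sbrk brk_sumr scaler_sumr. Qed.

Lemma sbrkC b c x y : shifted_parity b x -> shifted_parity c y ->
  sbrk b x y = sgn (b && c) *: sbrk c y x.
Proof.
case=> m hm em [n hn en]; rewrite /sbrk (brk_antisym _ _ _ _ hm hn).
rewrite expN1z oddzM em en -scaleNr -sgnN !scalerA -!sgnD; congr (sgn _ *: _).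
by case: b c {em en} => -[].
Qed.

Lemma diff_sbrk b x y : shifted_parity b x ->
  diff (sbrk b x y) = - (sbrk (~~ b) (diff x) y + sgn b *: sbrk b x (diff y)).
Proof.
case=> m hm em; rewrite /sbrk linearZ /= (diff_brk _ _ _ hm) expN1z em.
rewrite scalerDr opprD !scalerA -!sgnD -!scaleNr -!sgnN.
by case: b {em} => /=.
Qed.

(** The Jacobi identity in the form adapted to splittings: x stays in the first
    factor, as the least letter does in [splits]. *)
Lemma sbrk_jacobi b c d x y z :
  shifted_parity b x -> shifted_parity c y -> shifted_parity d z ->
  sbrk (~~ (b (+) c)) (sbrk b x y) z + sgn (c && d) *: sbrk (~~ (b (+) d)) (sbrk b x z) y
    + sgn b *: sbrk b x (sbrk c y z) = 0.
Proof.
case=> m hm em [n hn en] [p hp ep]; rewrite /sbrk !(brkZl, brkZr).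
rewrite (brk_jacobi _ _ _ _ _ _ hm hn hp) expN1z oddzM em en.
rewrite (brk_antisym _ _ _ _ hn (brk_homog _ _ _ _ hm hp)) expN1z oddzM oddzD em en ep.
rewrite !scalerA -!sgnD -scaleNr -sgnN !scalerDr !scalerA -!sgnD.
set X := brk (brk x y) z; set Y := brk (brk x z) y.
rewrite addrACA -!scalerDl.
have e0 (b1 b2 : bool) : b1 = ~~ b2 -> sgn b1 + sgn b2 = 0.
  by move=> ->; rewrite sgnN addNr.
rewrite !e0 ?scale0r ?addr0 //; by case: b c d {em en ep} => -[] -[].
Qed.

(** The right-hand side of the differential of the Whitehead model, with the
    values [g] in place of the generators. *)
Definition split_bracket (e : nat -> bool) (g : seq nat -> L) (w : seq nat) : L :=
  \sum_(AB <- splits w)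
    sgn (inv_parity e (AB.1 ++ AB.2)) *: sbrk (parity e AB.1) (g AB.1) (g AB.2).

End ShiftedBracket.

(** * Labelled trees and their values *)

Inductive ltree := LLeaf of nat | LNode of ltree & ltree.

Fixpoint ltree_enc (t : ltree) : GenTree.tree nat :=
  match t with
  | LLeaf i => GenTree.Leaf i
  | LNode l r => GenTree.Node 0 [:: ltree_enc l; ltree_enc r]
  end.

Fixpoint ltree_dec (t : GenTree.tree nat) : ltree :=
  match t with
  | GenTree.Leaf i => LLeaf i
  | GenTree.Node _ [:: l; r] => LNode (ltree_dec l) (ltree_dec r)
  | _ => LLeaf 0
  end.

Lemma ltree_encK : cancel ltree_enc ltree_dec.
Proof. by elim=> //= l -> r ->. Qed.

HB.instance Definition _ := Equality.copy ltree (can_type ltree_encK).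

Fixpoint leaf_word (t : ltree) : seq nat :=
  match t with LLeaf i => [:: i] | LNode l r => leaf_word l ++ leaf_word r end.

Definition lbalanced (t : ltree) : bool :=
  if t is LNode (LNode _ _) (LNode _ _) then true else false.

Fixpoint plant (T : btree) (w : seq nat) : ltree :=
  match T with
  | Leaf => LLeaf (head 0%N w)
  | Node l r => LNode (plant l (take (leaves l) w)) (plant r (drop (leaves l) w))
  end.

Lemma leaf_word_plant T w : size w = leaves T -> leaf_word (plant T w) = w.
Proof.
elim: T w => [|l IHl r IHr] w /=; first by case: w => [|i []].
move=> sw; rewrite -[RHS](cat_take_drop (leaves l)).
have lw : (leaves l <= size w)%N by rewrite sw leq_addr.
by rewrite IHl ?IHr ?size_take_min ?size_drop ?sw ?addKn //; apply/minn_idPl; rewrite leq_addr.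
Qed.

Section SignedTrees.
Variable e : nat -> bool.

(** Sorts the branches at every vertex by their first leaf, so that two
    trees with distinct leaf labels have the same result exactly when they
    differ by exchanges of branches; the boolean collects the Koszul signs of
    the exchanges. *)
Fixpoint canon (t : ltree) : bool * ltree :=
  match t with
  | LLeaf i => (false, LLeaf i)
  | LNode l r =>
      let cl := canon l in
      let cr := canon r in
      if (head 0 (leaf_word cl.2) < head 0 (leaf_word cr.2))%N
      then (cl.1 (+) cr.1, LNode cl.2 cr.2)
      else (cl.1 (+) cr.1 (+) (parity e (leaf_word l) && parity e (leaf_word r)),
            LNode cr.2 cl.2)
  end.

(** For a sorted word [w], the binary trees with leaf set [w] up to exchanges
    of branches: the branch containing the least leaf is on the left.  The
    recursion is on the two parts of a splitting, whence the bound [n]. *)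
Fixpoint signed_trees_rec (n : nat) (w : seq nat) : seq (bool * ltree) :=
  if n is n'.+1 then
    if w is [:: i] then [:: (false, LLeaf i)] else
    flatten [seq [seq (inv_parity e (AB.1 ++ AB.2) (+) s.1 (+) t.1, LNode s.2 t.2)
                 | s <- signed_trees_rec n' AB.1, t <- signed_trees_rec n' AB.2]
            | AB <- splits w]
  else [::].

Definition signed_trees (w : seq nat) := signed_trees_rec (size w) w.

Lemma signed_trees_recS n w : (1 < size w)%N ->
  signed_trees_rec n.+1 w =
    flatten [seq [seq (inv_parity e (AB.1 ++ AB.2) (+) s.1 (+) t.1, LNode s.2 t.2)
                 | s <- signed_trees_rec n AB.1, t <- signed_trees_rec n AB.2]
            | AB <- splits w].
Proof. by case: w => [|i [|j w]]. Qed.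

Lemma signed_trees_recE n w : (size w <= n)%N -> signed_trees_rec n w = signed_trees w.
Proof.
suff h m : forall w n, (size w <= m)%N -> (size w <= n)%N ->
    signed_trees_rec n w = signed_trees_rec m w.
  by move=> hn; apply: h.
elim: m => [|m IH] {}w {}n.
  by rewrite leqn0 size_eq0 => /eqP ->; case: n.
case: n => [|n]; first by rewrite (leqn0 (size w)) size_eq0 => _ /eqP ->.
case: (ltnP 1 (size w)) => [w1 hm hn|]; last by case: w => [|i []].
rewrite !signed_trees_recS //; congr flatten; apply/eq_in_map => -[A B] hAB.
have [_ _ sA sB] := splits_size hAB.
have sm x : (x < size w)%N -> (x <= m)%N by move=> xw; rewrite -ltnS (leq_trans xw).
have sn x : (x < size w)%N -> (x <= n)%N by move=> xw; rewrite -ltnS (leq_trans xw).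
by rewrite /= !(IH _ n) ?sm ?sn.
Qed.

Lemma signed_treesE w : (1 < size w)%N ->
  signed_trees w =
    flatten [seq [seq (inv_parity e (AB.1 ++ AB.2) (+) s.1 (+) t.1, LNode s.2 t.2)
                 | s <- signed_trees AB.1, t <- signed_trees AB.2] | AB <- splits w].
Proof.
move=> w1; rewrite -(@signed_trees_recE (size w).+1) // signed_trees_recS //; congr flatten.
apply/eq_in_map => -[A B] hAB; have [_ _ sA sB] := splits_size hAB.
by rewrite /= !(@signed_trees_recE (size w)) // ltnW.
Qed.

Lemma leaf_word_signed_trees w p : p \in signed_trees w -> perm_eq (leaf_word p.2) w.
Proof.
have [n] := ubnP (size w); elim: n w p => // n IH w p.
case: (ltnP 1 (size w)) => [w1 hn|]; last first.
  by case: w => [|i []] // _ _; rewrite /signed_trees /= inE => /eqP ->.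
rewrite signed_treesE // => /flattenP[r /mapP[[A B] hAB ->]].
have [_ _ sA sB] := splits_size hAB; have [_ _ _ _ pAB] := splitsP hAB.
case/allpairsP => -[s t] [/= hs ht ->] /=.
have sn x : (x < size w)%N -> (x < n)%N by move=> xw; apply: leq_trans xw _.
by rewrite -(permPr pAB) perm_cat ?(IH _ _ _ hs) ?(IH _ _ _ ht) ?sn.
Qed.

End SignedTrees.

Section Evaluation.
Variables (L : dglType) (K : {linear L -> L}) (deg : nat -> int) (e : nat -> bool) (y : nat -> L).
Hypotheses (hK : graded_map 1 K) (he : forall i, e i = oddz (deg i)).
Hypothesis hy : forall i, homog (deg i - 1) (y i).

Definition word_deg (w : seq nat) : int := \sum_(i <- w) deg i.

Lemma parity_word_deg w : parity e w = oddz (word_deg w).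
Proof.
elim: w => [|i w IH] /=; first by rewrite /word_deg big_nil.
by rewrite /word_deg big_cons oddzD he IH.
Qed.

Lemma shifted_parity_word_deg w x : homog (word_deg w - 1) x -> shifted_parity (parity e w) (x : L).
Proof. by exists (word_deg w - 1); rewrite // oddzD addbT parity_word_deg. Qed.

Definition on_branch (t : ltree) (x : L) : L := if t is LNode _ _ then K x else x.

(** Every inner edge carries the homotopy, the root does not. *)
Fixpoint tree_value (t : ltree) : L :=
  match t with
  | LLeaf i => y i
  | LNode l r => sbrk (parity e (leaf_word l))
      (on_branch l (tree_value l)) (on_branch r (tree_value r))
  end.

Definition branch_value t := on_branch t (tree_value t).

Lemma tree_value_homog t :
  homog (word_deg (leaf_word t) - (if t is LNode _ _ then 2 else 1)) (tree_value t) /\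
  homog (word_deg (leaf_word t) - 1) (branch_value t).
Proof.
elim: t => [i|l [_ IHl] r [_ IHr]]; first by rewrite /word_deg big_seq1.
have h : homog (word_deg (leaf_word (LNode l r)) - 2) (tree_value (LNode l r)).
  apply: homogZ; rewrite [word_deg _]big_cat /=.
  rewrite (_ : _ - 2 = (word_deg (leaf_word l) - 1) + (word_deg (leaf_word r) - 1)).
    exact: brk_homog.
  by rewrite addrACA.
split=> //; have := hK h.
by rewrite -addrA.
Qed.

Lemma branch_value_homog t : homog (word_deg (leaf_word t) - 1) (branch_value t).
Proof. by have [] := tree_value_homog t. Qed.

Lemma branch_value_parity t : shifted_parity (parity e (leaf_word t)) (branch_value t).
Proof. exact/shifted_parity_word_deg/branch_value_homog. Qed.

Lemma tree_value_Node l r : tree_value (LNode l r) =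
  sbrk (parity e (leaf_word l)) (branch_value l) (branch_value r).
Proof. by []. Qed.

Lemma canonP t : [/\ parity e (leaf_word (canon e t).2) = parity e (leaf_word t),
  tree_value t = sgn (canon e t).1 *: tree_value (canon e t).2 &
  branch_value t = sgn (canon e t).1 *: branch_value (canon e t).2].
Proof.
elim: t => [i|l [pl _ IHl] r [pr _ IHr]] /=; first by rewrite !scale1r.
have h : sbrk (parity e (leaf_word l)) (branch_value l) (branch_value r) =
    sgn (canon e (LNode l r)).1 *: tree_value (canon e (LNode l r)).2.
  rewrite IHl IHr -pl sbrkZl sbrkZr scalerA -sgnD /=.
  case: ifP => _ //; rewrite tree_value_Node.
  by rewrite (sbrkC (branch_value_parity _) (branch_value_parity _)) scalerA -sgnD pl pr.
split; first by case: ifP => _ /=; rewrite !parity_cat pl pr // addbC.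
  exact: h.
transitivity (K (sbrk (parity e (leaf_word l)) (branch_value l) (branch_value r))) => //.
by rewrite h linearZ /=; case: ifP.
Qed.

(** The image under phi of the generator indexed by [w], and below that of its
    boundary. *)
Definition word_value (w : seq nat) : L :=
  \sum_(p <- signed_trees e w) sgn p.1 *: branch_value p.2.

Definition word_bdry (w : seq nat) : L := split_bracket e word_value w.

Lemma word_value1 i : word_value [:: i] = y i.
Proof. by rewrite /word_value big_seq1 scale1r. Qed.

Lemma word_bdry1 i : word_bdry [:: i] = 0.
Proof. exact: big_nil. Qed.

Lemma word_bdry_trees w : (1 < size w)%N ->
  word_bdry w = \sum_(p <- signed_trees e w) sgn p.1 *: tree_value p.2.
Proof.
move=> w1; rewrite signed_treesE // big_flatten big_map.
apply: eq_big_seq => -[A B] hAB /=.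
rewrite big_allpairs_dep /= sbrk_suml scaler_sumr; apply: eq_big_seq => s hs.
rewrite sbrk_sumr scaler_sumr; apply: eq_bigr => t _.
rewrite sbrkZl sbrkZr !scalerA -!sgnD; congr (_ *: _).
by rewrite (parity_perm e (leaf_word_signed_trees hs)) !addbA.
Qed.

Lemma word_valueE w : (1 < size w)%N -> word_value w = K (word_bdry w).
Proof.
move=> w1; rewrite word_bdry_trees // linear_sum; apply: eq_big_seq => p hp.
rewrite linearZ /=; case: p hp => b [i|l r] // /leaf_word_signed_trees /= /perm_size sw.
by rewrite -sw in w1.
Qed.

Lemma word_value_homog w : homog (word_deg w - 1) (word_value w).
Proof.
rewrite /word_value big_seq; apply: homog_sum => p /leaf_word_signed_trees hp; apply: homogZ.
by rewrite -[word_deg w](perm_big _ hp); apply: branch_value_homog.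
Qed.

Lemma word_value_parity w : shifted_parity (parity e w) (word_value w).
Proof. exact/shifted_parity_word_deg/word_value_homog. Qed.

(** The boundary of a product u_A o u_B has terms (u_A1 o u_A2) o u_B and
    u_A o (u_B1 o u_B2).  The first list holds the former; the second one
    holds what the Jacobi identity makes of the latter, also in the form
    (x o y) o z and up to a global sign. *)
Definition triples_l (w : seq nat) : seq (bool * (seq nat * seq nat * seq nat)) :=
  flatten [seq [seq (inv_parity e (AB.1 ++ AB.2) (+) inv_parity e (A12.1 ++ A12.2),
                     (A12.1, A12.2, AB.2))
     | A12 <- splits AB.1] | AB <- splits w].

Definition triples_r (w : seq nat) : seq (bool * (seq nat * seq nat * seq nat)) :=
  flatten [seq flatten [seq
      let b := inv_parity e (AB.1 ++ AB.2) (+) inv_parity e (B12.1 ++ B12.2) in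
      [:: (b, (AB.1, B12.1, B12.2));
          (b (+) (parity e B12.1 && parity e B12.2), (AB.1, B12.2, B12.1))]
     | B12 <- splits AB.2] | AB <- splits w].

(** The image of omega is a cycle: the terms of its boundary cancel by the
    Jacobi identity, provided that the two lists of triples agree. *)
Lemma diff_word_bdry w :
  (forall A, subseq A w -> (size A < size w)%N -> diff (word_value A) = word_bdry A) ->
  perm_eq (triples_l w) (triples_r w) -> diff (word_bdry w) = 0.
Proof.
move=> hA hw.
pose f (p : bool * (seq nat * seq nat * seq nat)) : L := let: (b, (A, B, C)) := p in
  sgn b *: sbrk (~~ (parity e A (+) parity e B))
    (sbrk (parity e A) (word_value A) (word_value B)) (word_value C).
have el : \sum_(AB <- splits w) sgn (inv_parity e (AB.1 ++ AB.2)) *: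
    sbrk (~~ parity e AB.1) (word_bdry AB.1) (word_value AB.2) = \sum_(p <- triples_l w) f p.
  rewrite big_flatten big_map; apply: eq_bigr => -[A B] _ /=.
  rewrite big_map sbrk_suml scaler_sumr; apply: eq_big_seq => -[A1 A2] /splitsP[_ _ _ _ pA] /=.
  by rewrite sbrkZl scalerA -sgnD -(parity_perm e pA) parity_cat.
have er : \sum_(AB <- splits w) sgn (inv_parity e (AB.1 ++ AB.2)) *: (sgn (parity e AB.1) *:
    sbrk (parity e AB.1) (word_value AB.1) (word_bdry AB.2)) = - \sum_(p <- triples_r w) f p.
  rewrite big_flatten big_map -sumrN; apply: eq_bigr => -[A B] _ /=.
  rewrite big_flatten big_map sbrk_sumr !scaler_sumr -sumrN; apply: eq_bigr => -[B1 B2] _ /=.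
  rewrite big_cons big_seq1 /= sbrkZr.
  have := sbrk_jacobi (word_value_parity A) (word_value_parity B1) (word_value_parity B2).
  move/(canRL (addKr _)); rewrite addr0.
  set b := inv_parity _ _; set c := inv_parity _ _ => h.
  rewrite (scalerA _ (sgn c)) (mulrC _ (sgn c)) -(scalerA (sgn c)) h !scalerN scalerDr.
  by rewrite !scalerDr !scalerA -!sgnD.
transitivity (- (\sum_(p <- triples_l w) f p - \sum_(p <- triples_r w) f p)); last first.
  by rewrite (perm_big _ hw) subrr oppr0.
rewrite -el -er -big_split -sumrN linear_sum; apply: eq_big_seq => -[A B] hAB /=.
have [_ _ sA sB _] := splitsP hAB; have [_ _ zA zB] := splits_size hAB.
by rewrite linearZ /= (diff_sbrk _ (word_value_parity A)) !hA // scalerN scalerDr.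
Qed.

End Evaluation.

(** * Transferred brackets as sums over labelled trees *)

(** The sign exponent of the shift of a tensor: the sum of (k - j) |v_j|. *)
Fixpoint staircase (c : nat -> bool) (w : seq nat) : bool :=
  if w is i :: w' then (odd (size w') && c i) (+) staircase c w' else false.

Lemma staircase_cat c u v :
  staircase c (u ++ v) = staircase c u (+) (odd (size v) && parity c u) (+) staircase c v.
Proof.
elim: u => [|i u IH] /=; first by rewrite andbF.
rewrite IH size_cat oddD.
by case: (odd (size u)); case: (odd (size v)); case: (c i); case: (staircase c u);
  case: (parity c u); case: (staircase c v).
Qed.

Lemma parity_negb c w : parity (fun i => ~~ c i) w = parity c w (+) odd (size w).
Proof. by elim: w => //= i w ->; case: (c i); case: (parity c w); case: odd. Qed.

Section TreeMap.
Variables (L : dglType) (R : homotopy_retract L) (deg : nat -> int) (e : nat -> bool).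
Variable x : nat -> homology L.
Hypothesis he : forall i, e i = oddz (deg i).

Let y i := hr_i R (x i).

(** At a vertex with left inputs of total degree D and r leaves on the right,
    the sign convention of the transfer and that of the shifted bracket differ
    by (-1)^(r D).  Summed over the vertices, each |v_j| is counted once for
    every leaf to the right of the leaf j, whatever the tree. *)
Lemma tree_map_value T w : size w = leaves T ->
  tree_map R T [seq (deg i - 1, x i) | i <- w] =
    sgn (staircase (fun i => ~~ e i) w) *: tree_value (hr_K R) e y (plant T w).
Proof.
elim: T w => [|l IHl r IHr] w /=.
  by case: w => [|i []] // _; rewrite scale1r.
move=> sw; have lw : (leaves l <= size w)%N by rewrite sw leq_addr.
rewrite -map_take -map_drop.
have su : size (take (leaves l) w) = leaves l by rewrite size_take_min; apply/minn_idPl.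
have sv : size (drop (leaves l) w) = leaves r by rewrite size_drop sw addKn.
rewrite -[in RHS](cat_take_drop (leaves l) w) staircase_cat.
rewrite take_size_cat // drop_size_cat // leaf_word_plant //.
move: (take _ w) (drop _ w) su sv => u v su sv.
rewrite IHl // IHr //.
have hb T (c : bool) (z : seq nat) :
    tree_branch R T (sgn c *: tree_value (hr_K R) e y (plant T z))
      = sgn c *: on_branch (hr_K R) (plant T z) (tree_value (hr_K R) e y (plant T z)).
  by case: T => //= *; rewrite linearZ.
rewrite !hb // brkZl brkZr /sbrk !scalerA; congr (_ *: _).
have -> : \sum_(p <- [seq (deg i - 1, x i) | i <- u]) p.1 = word_deg deg u - (size u)%:Z.
  rewrite big_map /= /word_deg sumrB; congr (_ - _).
  by rewrite big_const_seq count_predT iter_addr_0 natz.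
have odd1 n : (0 < n)%N -> odd (n - 1) = ~~ odd n by case: n => // n _; rewrite subn1 /= negbK.
rewrite expN1z oddzM oddzD oddzN -(parity_word_deg he) -signr_odd odd1 ?leaves_gt0 //.
rewrite -[(-1) ^+ _]/(sgn _) -!sgnD; congr sgn.
rewrite /oddz !absz_nat odd1 ?leaves_gt0 // parity_negb su sv.
by case: (odd (leaves l)); case: (odd (leaves r)); case: (parity e u);
  case: (staircase _ u); case: (staircase _ v).
Qed.

End TreeMap.

Section FourLetters.
Variables b0 b1 b2 b3 : bool.
Let e := nth false [:: b0; b1; b2; b3].

Lemma triples4 : perm_eq (triples_l e (iota 0 4)) (triples_r e (iota 0 4)).
Proof. by rewrite /e; case: b0 b1 b2 b3 => -[] [] []; vm_compute. Qed.

(** The signature and the Koszul sign of the degrees combine to the Koszul sign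
    of the degrees shifted by one.  Here [~~ e i] is the parity of the degree of
    the letter i. *)
Lemma staircase_perm_words4 : all (fun p =>
  p.1 (+) inv_parity (fun i => ~~ e i) p.2 (+) staircase (fun i => ~~ e i) p.2
    == staircase (fun i => ~~ e i) (iota 0 4) (+) inv_parity e p.2) (perm_words 4).
Proof. by rewrite /e; case: b0 b1 b2 b3 => -[] [] []; vm_compute. Qed.

(** Each labelled tree of the shape of [T] arises from |Aut T| permutations of
    its leaves, all with the sign that it has in the boundary formula. *)
Lemma canon_plant4 T : leaves T = 4%N ->
  perm_eq [seq (inv_parity e p.2 (+) (canon e (plant T p.2)).1, (canon e (plant T p.2)).2)
            | p <- perm_words 4]
    (flatten (nseq (if is_balanced T then 8 else 2)
       [seq q <- signed_trees e (iota 0 4) | lbalanced q.2 == is_balanced T])).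
Proof.
case/four_leaf_treesP => i hi ->.
rewrite /e; case: i hi => [|[|[|[|[|//]]]]] _; case: b0 b1 b2 b3 => -[] [] []; by vm_compute.
Qed.

End FourLetters.

Section Transferred.
Variables (L : dglType) (R : homotopy_retract L) (d1 d2 d3 d4 : int).
Variables (x1 x2 x3 x4 : homology L) (Ts : seq btree).
Hypothesis hTs : plane_drawings 4 Ts.

Let deg := nth 0 [:: d1 + 1; d2 + 1; d3 + 1; d4 + 1].
Let e := nth false [:: oddz (d1 + 1); oddz (d2 + 1); oddz (d3 + 1); oddz (d4 + 1)].
Let y i := hr_i R (nth 0 [:: x1; x2; x3; x4] i).
Hypothesis hy : forall i, homog (deg i - 1) (y i).

(** The factor 1/|Aut T| cancels the number of permutations that give the same
    labelled tree, so that each tree of the boundary formula appears once. *)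
Lemma transferred4 :
  transferred R Ts [tuple d1; d2; d3; d4] [tuple x1; x2; x3; x4]
    = (-1) ^ (3 * d1 + 2 * d2 + d3) *: hr_q R (word_bdry (hr_K R) e y (iota 0 4)).
Proof.
have he i : e i = oddz (deg i) by case: i => [|[|[|[|i]]]]; rewrite /e /deg /= ?nth_nil.
have [lTs _ _] := hTs.
(* the part of phi(omega) made of the trees of one shape *)
pose S b := \sum_(q <- signed_trees e (iota 0 4) | lbalanced q.2 == b)
  sgn q.1 *: tree_value (hr_K R) e y q.2.
pose sg := staircase (fun i => ~~ e i) (iota 0 4).
have -> : (-1) ^ (3 * d1 + 2 * d2 + d3) = sgn sg.
  rewrite expN1z !oddzD !oddzM /sg /e /= !oddzD.
  by case: (oddz d1); case: (oddz d2); case: (oddz d3).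
rewrite word_bdry_trees //.
have -> : \sum_(p <- signed_trees e (iota 0 4)) sgn p.1 *: tree_value (hr_K R) e y p.2 =
    S true + S false.
  rewrite (bigID (fun q => lbalanced q.2)) /=.
  by congr (_ + _); apply: eq_bigl => q; case: (lbalanced _).
rewrite linearD scalerDr -(sum_plane_drawings4 (fun b => sgn sg *: hr_q R (S b)) hTs).
rewrite /transferred !(big_nth Leaf) !big_mkord; apply: eq_bigr => i _.
move: (nth Leaf Ts i) (eqP (all_nthP Leaf lTs i (ltn_ord i))) => T lT.
rewrite card_tree_isos4 // eqxx; set c := (if _ then _ else _)%N.
have c0 : c%:R != 0 :> rat by rewrite /c; case: ifP.
have hc := canon_plant4 (oddz (d1 + 1)) (oddz (d2 + 1)) (oddz (d3 + 1)) (oddz (d4 + 1)) lT.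
rewrite -[nth _ _]/e in hc.
have hs := staircase_perm_words4 (oddz (d1 + 1)) (oddz (d2 + 1)) (oddz (d3 + 1)) (oddz (d4 + 1)).
rewrite -[nth _ _]/e in hs.
transitivity (c%:R^-1 *: hr_q R (sgn sg *: (S (is_balanced T) *+ c))); last first.
  by rewrite linearZ linearMn /= -scaler_nat !scalerA mulrCA mulVf // mulr1.
congr (_ *: hr_q R _).
pose F (b : bool) w := (sgn b * sgn (inv_parity (fun i => ~~ e i) w)) *:
  tree_map R T [seq (deg i - 1, nth 0 [:: x1; x2; x3; x4] i) | i <- w].
transitivity (\sum_(s : 'S_4) F (odd_perm s) (perm_word s)).
  apply: eq_bigr => s _; rewrite /F; congr ((_ * _) *: _).
    apply: koszul_word => a; rewrite (tnth_nth 0) /e.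
    by case: a => -[|[|[|[|]]]] //= _; rewrite oddzD addbT negbK.
  congr tree_map; rewrite /perm_word -map_comp; apply: eq_map => a /=.
  rewrite !(tnth_nth 0) /deg.
  by case: (s a) => -[|[|[|[|]]]] //= _; rewrite addrK.
rewrite sum_perm_words.
have -> : S (is_balanced T) *+ c = \sum_(p <- perm_words 4)
    sgn (inv_parity e p.2) *: tree_value (hr_K R) e y (plant T p.2).
  pose ts := [seq q <- signed_trees e (iota 0 4) | lbalanced q.2 == is_balanced T].
  transitivity (\sum_(q <- flatten (nseq c ts)) sgn q.1 *: tree_value (hr_K R) e y q.2).
    by rewrite big_flatten big_nseq iter_addr_0 big_filter.
  rewrite -(perm_big _ hc) big_map; apply: eq_bigr => p _ /=.
  by have [_ -> _] := canonP (hr_K_deg R) he hy (plant T p.2); rewrite scalerA -sgnD.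
rewrite scaler_sumr; apply: eq_big_seq => p hp; rewrite /F.
have sp : size p.2 = leaves T.
  have : all (fun p => size p.2 == 4%N) (perm_words 4) by vm_compute.
  by rewrite lT => /allP/(_ _ hp)/eqP.
rewrite (tree_map_value R _ he sp) !scalerA -!sgnD; congr (sgn _ *: _).
exact/eqP/(allP hs).
Qed.

End Transferred.

(** * Cycles and boundaries *)

Section Boundaries.
Variable L : dglType.
Implicit Types x y z : L.

Definition boundary x : Prop := exists z, x = diff z.

Lemma boundaryD x y : boundary x -> boundary y -> boundary (x + y).
Proof. by case=> u -> [v ->]; exists (u + v); rewrite linearD. Qed.

Lemma boundaryZ c x : boundary x -> boundary (c *: x).
Proof. by case=> u ->; exists (c *: u); rewrite linearZ. Qed.

Lemma represents_homologous x y h : represents x h -> represents y h -> boundary (x - y).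
Proof. by case=> c <- <- [c' <-] /eqP; rewrite eq_sym => /clsP. Qed.

Lemma represents_diff x h : represents x h -> diff x = 0.
Proof. by case=> c <- _; apply: diff_cycle. Qed.

Section Retract.
Variable R : homotopy_retract L.

Lemma retract_represents x : diff x = 0 -> represents x (hr_q R x).
Proof.
move=> dx; have cx : x \in @cycle_pred L by rewrite unfold_in dx.
exists (Cycle cx) => //; have [c ec <-] := hr_i_id R (hr_q R x).
apply: (@clsE _ _ _ (hr_K R x)); rewrite -[diff _]addr0 -(linear0 (hr_K R)) -dx.
by rewrite -(hr_homotopy R x) -ec.
Qed.

(** The homotopy provides a preimage of every boundary. *)
Lemma boundary_retract x : boundary x -> diff (hr_K R x) = x.
Proof.
case=> z ->; have := hr_homotopy R (diff z).
by rewrite diff_diff linear0 addr0 hr_q_chain linear0 subr0.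
Qed.

End Retract.

Lemma abelian_boundary x y : abelian_lie (homology L) ->
  diff x = 0 -> diff y = 0 -> boundary (brk x y).
Proof.
move=> abL dx dy; have cx : x \in @cycle_pred L by rewrite unfold_in dx.
have cy : y \in @cycle_pred L by rewrite unfold_in dy.
have := abL (cls (Cycle cx)) (cls (Cycle cy)).
by rewrite {1}/brk /= hbrkE => /eqP/cls_eq0.
Qed.

End Boundaries.

(** * Triple brackets *)

Section TripleBrackets.
Variable L : dglType.
Implicit Types (a c : L) (n : int).

Definition shifted_homog n a : Prop := homog (n - 1) a.

Lemma shifted_homog_parity n a : shifted_homog n a -> shifted_parity (oddz n) a.
Proof. by exists (n - 1); rewrite // oddzD addbT. Qed.

(** The boundary formula for three letters: a12 bounds a1 o a2, and so on. *)
Definition triple_bracket n1 n2 n3 a1 a2 a3 a12 a13 a23 : L :=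
  sbrk (oddz (n1 + n2)) a12 a3 + sgn (oddz n2 && oddz n3) *: sbrk (oddz (n1 + n3)) a13 a2
    + sbrk (oddz n1) a1 a23.

(** The triple product of the classes of a1, a2, a3 is defined and contains zero. *)
Definition null_triple n1 n2 n3 a1 a2 a3 : Prop :=
  exists a12 a13 a23,
    [/\ shifted_homog (n1 + n2) a12, shifted_homog (n1 + n3) a13 & shifted_homog (n2 + n3) a23] /\
    [/\ diff a12 = sbrk (oddz n1) a1 a2, diff a13 = sbrk (oddz n1) a1 a3,
        diff a23 = sbrk (oddz n2) a2 a3
      & boundary (triple_bracket n1 n2 n3 a1 a2 a3 a12 a13 a23)].

Section Symmetry.
Variables (n1 n2 n3 : int) (a1 a2 a3 : L).
Hypotheses (h1 : shifted_homog n1 a1) (h2 : shifted_homog n2 a2) (h3 : shifted_homog n3 a3).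

(** Symmetry under the two transpositions makes it enough to vary the first
    argument in [null_triple_shift]. *)
Lemma null_triple_swap12 : null_triple n1 n2 n3 a1 a2 a3 -> null_triple n2 n1 n3 a2 a1 a3.
Proof.
case=> a12 [a13 [a23 [[s12 s13 s23] [e12 e13 e23 bM]]]].
exists (sgn (oddz n1 && oddz n2) *: a12), a23, a13; split.
  by split=> //; rewrite (addrC n2); apply: homogZ.
have [p1 p2] := (shifted_homog_parity h1, shifted_homog_parity h2).
split=> //; first by rewrite linearZ /= e12 (sbrkC p1 p2) scalerA sgn_mul scale1r.
suff -> : triple_bracket n2 n1 n3 a2 a1 a3 (sgn (oddz n1 && oddz n2) *: a12) a23 a13
    = sgn (oddz n1 && oddz n2) *: triple_bracket n1 n2 n3 a1 a2 a3 a12 a13 a23 by apply: boundaryZ.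
rewrite /triple_bracket sbrkZl (addrC n2 n1) !scalerDr -!addrA; congr (_ + _).
rewrite addrC; congr (_ + _).
  rewrite (sbrkC p2 (shifted_homog_parity s13)) !scalerA -!sgnD; congr (sgn _ *: _).
  by rewrite oddzD; case: (oddz n1) (oddz n2) (oddz n3) => -[] [].
rewrite (sbrkC p1 (shifted_homog_parity s23)) !scalerA -!sgnD; congr (sgn _ *: _).
by rewrite oddzD; case: (oddz n1) (oddz n2) (oddz n3) => -[] [].
Qed.

Lemma null_triple_swap23 : null_triple n1 n2 n3 a1 a2 a3 -> null_triple n1 n3 n2 a1 a3 a2.
Proof.
case=> a12 [a13 [a23 [[s12 s13 s23] [e12 e13 e23 bM]]]].
exists a13, a12, (sgn (oddz n2 && oddz n3) *: a23); split.
  by split=> //; rewrite (addrC n3); apply: homogZ.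
split=> //.
  rewrite linearZ /= e23 (sbrkC (shifted_homog_parity h2) (shifted_homog_parity h3)).
  by rewrite scalerA sgn_mul scale1r.
suff -> : triple_bracket n1 n3 n2 a1 a3 a2 a13 a12 (sgn (oddz n2 && oddz n3) *: a23)
    = sgn (oddz n2 && oddz n3) *: triple_bracket n1 n2 n3 a1 a2 a3 a12 a13 a23 by apply: boundaryZ.
rewrite /triple_bracket sbrkZr !scalerDr (scalerA _ _ (sbrk (oddz (n1 + n3)) a13 a2)).
rewrite sgn_mul scale1r andbC.
by congr (_ + _); rewrite addrC.
Qed.

Hypotheses (d2 : diff a2 = 0) (d3 : diff a3 = 0).

(** Correcting a12 and a13 by c o a2 and c o a3, the Jacobi identity shows that
    the triple bracket changes by the boundary of c o a23. *)
Lemma null_triple_shift c : homog n1 c ->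
  null_triple n1 n2 n3 a1 a2 a3 -> null_triple n1 n2 n3 (a1 + diff c) a2 a3.
Proof.
move=> hc [a12 [a13 [a23 [[s12 s13 s23] [e12 e13 e23 bM]]]]].
have pc : shifted_parity (~~ oddz n1) c by exists n1; rewrite ?negbK.
have sc n a : shifted_homog n a -> shifted_homog (n1 + n) (sbrk (~~ oddz n1) c a).
  by move=> ha; apply: homogZ; rewrite -addrA; apply: brk_homog.
have dc a : diff a = 0 -> diff (sbrk (~~ oddz n1) c a) = - sbrk (oddz n1) (diff c) a.
  move=> da; rewrite (diff_sbrk _ pc) da negbK.
  by rewrite [X in _ + _ *: X]/sbrk brk0r !scaler0 addr0.
exists (a12 - sbrk (~~ oddz n1) c a2), (a13 - sbrk (~~ oddz n1) c a3), a23; split.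
  by split=> //; apply: homogB => //; apply: sc.
split=> //.
- by rewrite linearB /= dc // opprK e12 sbrkDl.
- by rewrite linearB /= dc // opprK e13 sbrkDl.
suff -> : triple_bracket n1 n2 n3 (a1 + diff c) a2 a3 (a12 - sbrk (~~ oddz n1) c a2)
      (a13 - sbrk (~~ oddz n1) c a3) a23
    = triple_bracket n1 n2 n3 a1 a2 a3 a12 a13 a23 - diff (sbrk (~~ oddz n1) c a23).
  by apply: boundaryD => //; exists (- sbrk (~~ oddz n1) c a23); rewrite linearN.
have := sbrk_jacobi pc (shifted_homog_parity h2) (shifted_homog_parity h3).
rewrite !addNb !negbK -!oddzD -e23 => /(canRL (addrK _)); rewrite sub0r => J.
rewrite (diff_sbrk _ pc) opprK negbK /triple_bracket.
rewrite -[sbrk (~~ _) c a2 in LHS]opprK.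
rewrite !(sbrkDl, sbrkNl) !opprK scalerDr scalerN.
rewrite (addrACA (sbrk _ a12 a3)) -opprD J opprK.
by rewrite -!addrA; do 2 congr (_ + _); rewrite addrC -addrA.
Qed.

End Symmetry.

Lemma null_triple_homologous n1 n2 n3 a1 a2 a3 c1 c2 c3 :
  homog n1 c1 -> homog n2 c2 -> homog n3 c3 ->
  shifted_homog n1 a1 -> shifted_homog n2 a2 -> shifted_homog n3 a3 ->
  diff a1 = 0 -> diff a2 = 0 -> diff a3 = 0 -> null_triple n1 n2 n3 a1 a2 a3 ->
  null_triple n1 n2 n3 (a1 + diff c1) (a2 + diff c2) (a3 + diff c3).
Proof.
move=> hc1 hc2 hc3 h1 h2 h3 d1 d2 d3 N.
have hD n a c : shifted_homog n a -> homog n c -> shifted_homog n (a + diff c).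
  by move=> ha hc; apply: homogD => //; apply: diff_homog.
have dD a c : diff a = 0 -> diff (a + diff c) = 0.
  by move=> da; rewrite linearD /= da diff_diff addr0.
have {}N := null_triple_swap12 (hD _ _ _ h1 hc1) h2 (null_triple_shift h2 h3 d2 d3 hc1 N).
have {}N := null_triple_shift (hD _ _ _ h1 hc1) h3 (dD _ _ d1) d3 hc2 N.
have {}N := null_triple_swap12 (hD _ _ _ h2 hc2) (hD _ _ _ h1 hc1) N.
have {}N := null_triple_swap23 (hD _ _ _ h2 hc2) h3 N.
have {}N := null_triple_swap12 (hD _ _ _ h1 hc1) h3 N.
have {}N := null_triple_shift (hD _ _ _ h1 hc1) (hD _ _ _ h2 hc2) (dD _ _ d1) (dD _ _ d2) hc3 N.
have {}N := null_triple_swap12 (hD _ _ _ h3 hc3) (hD _ _ _ h1 hc1) N.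
exact: null_triple_swap23 (hD _ _ _ h3 hc3) (hD _ _ _ h2 hc2) N.
Qed.

(** Two choices of bounding elements differ by cycles, and brackets of cycles
    are boundaries since the homology is abelian. *)
Lemma boundary_triple_bracket n1 n2 n3 a1 a2 a3 a12 a13 a23 : abelian_lie (homology L) ->
  diff a1 = 0 -> diff a2 = 0 -> diff a3 = 0 ->
  diff a12 = sbrk (oddz n1) a1 a2 -> diff a13 = sbrk (oddz n1) a1 a3 ->
  diff a23 = sbrk (oddz n2) a2 a3 ->
  null_triple n1 n2 n3 a1 a2 a3 -> boundary (triple_bracket n1 n2 n3 a1 a2 a3 a12 a13 a23).
Proof.
move=> abL d1 d2 d3 e12 e13 e23 [a12' [a13' [a23' [_ [e12' e13' e23' bM]]]]].
have bB b (x y : L) : diff x = 0 -> diff y = 0 -> boundary (sbrk b x y).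
  by move=> dx dy; apply: boundaryZ; apply: abelian_boundary.
rewrite -[triple_bracket _ _ _ _ _ _ _ _ _](subrK
  (triple_bracket n1 n2 n3 a1 a2 a3 a12' a13' a23')).
apply: boundaryD bM.
rewrite (_ : _ - _ = triple_bracket n1 n2 n3 a1 a2 a3 (a12 - a12') (a13 - a13') (a23 - a23')).
  apply: boundaryD; [apply: boundaryD; [|apply: boundaryZ]|]; apply: bB => //.
  - by rewrite linearB /= e12 e12' subrr.
  - by rewrite linearB /= e13 e13' subrr.
  - by rewrite linearB /= e23 e23' subrr.
rewrite /triple_bracket !(sbrkDl, sbrkDr, sbrkNl, sbrkNr) scalerDr scalerN !opprD.
by rewrite addrACA; congr (_ + _); rewrite addrACA.
Qed.

End TripleBrackets.

(** * The morphism built from the homotopy retract *)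

Section Morphisms.
Variables (k : nat) (n : 'I_k -> int) (e : nat -> bool) (L : dglType).
Variable f : {linear whLie n -> L}.
Hypothesis he : forall j : 'I_k, e (val j) = oddz (n j).
Hypothesis f_brk : forall x y, f (brk x y) = brk (f x) (f y).

Definition gen_value (w : seq nat) : L := f (wh_gen n (set_of k w)).

Lemma morphism_wh_bdry w : (size w <= 4)%N -> subseq w (iota 0 k) ->
  f (wh_bdry n (set_of k w)) = split_bracket e gen_value w.
Proof.
move=> sw hw; rewrite (wh_bdryE he) -?size_elts ?elts_set_of //.
rewrite linear_sum; apply: eq_bigr => -[A B] _ /=.
by rewrite linearZ /= f_brk /sbrk scalerA mulrC.
Qed.

End Morphisms.

Section SumSplits.
Variables (L : dglType) (deg : nat -> int) (e : nat -> bool) (g : seq nat -> L).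
Hypothesis he : forall i, e i = oddz (deg i).

Lemma split_bracket2 i j : (i < j)%N ->
  split_bracket e g [:: i; j] = sbrk (oddz (deg i)) (g [:: i]) (g [:: j]).
Proof.
move=> ij; rewrite /split_bracket big_seq1 /= (ltnNge j) (ltnW ij) scale1r.
by rewrite addbF he.
Qed.

Lemma split_bracket3 i j k : (i < j)%N -> (j < k)%N ->
  split_bracket e g [:: i; j; k] =
    triple_bracket (deg i) (deg j) (deg k) (g [:: i]) (g [:: j]) (g [:: k])
        (g [:: i; j]) (g [:: i; k]) (g [:: j; k]).
Proof.
move=> ij jk; have ik := ltn_trans ij jk.
rewrite /split_bracket [splits _]/= 2!big_cons big_seq1 /=.
rewrite (ltnNge j) (ltnW ij) (ltnNge k i) (ltnW ik).
rewrite (ltnNge k j) (ltnW jk) jk /= !scale1r !addbF addrA /triple_bracket.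
by rewrite !oddzD !he andbC.
Qed.

End SumSplits.

Section Main.
Variables (L : dglType) (abL : abelian_lie (homology L)) (R : homotopy_retract L).
Variables (d1 d2 d3 d4 : int) (x1 x2 x3 x4 : homology L).
Hypotheses (hx1 : homog d1 x1) (hx2 : homog d2 x2) (hx3 : homog d3 x3) (hx4 : homog d4 x4).

Let n (j : 'I_4) := tnth [tuple d1; d2; d3; d4] j + 1.
Let deg := nth 0 [:: d1 + 1; d2 + 1; d3 + 1; d4 + 1].
Let e := nth false [:: oddz (d1 + 1); oddz (d2 + 1); oddz (d3 + 1); oddz (d4 + 1)].
Let x := nth 0 [:: x1; x2; x3; x4].
Let y i := hr_i R (x i).
Let K := hr_K R.

Lemma oddz_letter i : e i = oddz (deg i).
Proof. by case: i => [|[|[|[|i]]]]; rewrite /e /deg /= ?nth_nil. Qed.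

Lemma n_letter (j : 'I_4) : n j = deg (val j).
Proof. by rewrite /n (tnth_nth 0); case: j => -[|[|[|[|]]]]. Qed.

Lemma e_letter (j : 'I_4) : e (val j) = oddz (n j).
Proof. by rewrite n_letter oddz_letter. Qed.

Lemma y_homog i : homog (deg i - 1) (y i).
Proof.
have h m z : homog m z -> homog (m + 1 - 1) (hr_i R z).
  by move=> hz; rewrite addrK -[m]addr0; apply: hr_i_deg.
by case: i => [|[|[|[|i]]]]; rewrite /deg /y /x /= ?nth_nil; try exact: h;
  rewrite linear0; apply: homog0.
Qed.

Lemma y_cycle i : diff (y i) = 0.
Proof. exact: hr_i_chain. Qed.

Lemma word_gt0_lt4 (I : wh_index 4) : (0 < size (elts (val I)) < 4)%N.
Proof. by rewrite size_elts; apply: (valP I). Qed.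

Lemma word_value_gen_homog (I : wh_index 4) : homog (wh_deg n I) (word_value K e y (elts (val I))).
Proof.
have := word_value_homog e (hr_K_deg R) y_homog (elts (val I)).
rewrite /word_deg big_map big_enum /wh_deg /set_deg /=.
by under eq_bigr do rewrite -n_letter.
Qed.

Let f (I : wh_index 4) := word_value K e y (elts (val I)).
Let phi : {linear whLie n -> L} := free_ext word_value_gen_homog.

Lemma phi_wh_gen w : subseq w (iota 0 4) -> (0 < size w < 4)%N ->
  phi (wh_gen n (set_of 4 w)) = word_value K e y w.
Proof.
move=> hw sw; rewrite /wh_gen insubT; first by rewrite -size_elts elts_set_of.
by move=> hI; rewrite [LHS](free_ext_gen word_value_gen_homog) /= elts_set_of.
Qed.

Lemma phi_wh_bdry w : subseq w (iota 0 4) -> phi (wh_bdry n (set_of 4 w)) = word_bdry K e y w.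
Proof.
move=> hw; have sw : (size w <= 4)%N by have := size_subseq hw; rewrite size_iota.
rewrite (morphism_wh_bdry e_letter) //; last exact: free_ext_brk.
apply: eq_big_seq => -[A B] hAB; have [_ _ sA sB _] := splitsP hAB.
have [A0 B0 A4 B4] := splits_size hAB; congr (_ *: sbrk _ _ _).
  by apply: phi_wh_gen; rewrite ?(subseq_trans sA) // A0 (leq_trans A4).
by apply: phi_wh_gen; rewrite ?(subseq_trans sB) // B0 (leq_trans B4).
Qed.

Lemma word_bdry2 i j : (i < j)%N -> word_bdry K e y [:: i; j] = sbrk (oddz (deg i)) (y i) (y j).
Proof.
by move=> ij; rewrite /word_bdry (split_bracket2 (word_value K e y) oddz_letter ij) !word_value1.
Qed.

Lemma word_bdry3 i j k : (i < j)%N -> (j < k)%N -> word_bdry K e y [:: i; j; k] =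
  triple_bracket (deg i) (deg j) (deg k) (y i) (y j) (y k)
    (word_value K e y [:: i; j]) (word_value K e y [:: i; k]) (word_value K e y [:: j; k]).
Proof.
move=> ij jk; rewrite /word_bdry (split_bracket3 (word_value K e y) oddz_letter ij jk).
by rewrite !word_value1.
Qed.

Lemma sorted_word w : subseq w (iota 0 4) -> sorted ltn w.
Proof. by move=> hw; apply: subseq_sorted hw _ => //; apply: ltn_trans. Qed.

Lemma diff_word_value2 i j : (i < j)%N ->
  diff (word_value K e y [:: i; j]) = sbrk (oddz (deg i)) (y i) (y j).
Proof.
move=> ij; rewrite word_valueE // boundary_retract word_bdry2 //.
by apply: boundaryZ; apply: abelian_boundary => //; apply: y_cycle.
Qed.

(** Any morphism from the Whitehead model provides the vanishing of the triple
    brackets of its values on the generators, which are homologous to the y_i. *)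
Section GivenMorphism.
Variable psi : {linear whLie n -> L}.
Hypothesis psi_dgl : dgl_morphism psi.
Hypothesis psi_gen : forall j : 'I_4,
  represents (psi (wh_gen n [set j])) (tnth [tuple x1; x2; x3; x4] j).

Let g := gen_value psi.

Lemma g_homog w : subseq w (iota 0 4) -> homog (word_deg deg w - 1) (g w).
Proof.
move=> hw; have [hpsi _ _] := psi_dgl.
have := hpsi _ _ (wh_gen_homog n (set_of 4 w)); rewrite addr0 -/(gen_value psi w).
have -> // : set_deg n (set_of 4 w) = word_deg deg w - 1.
rewrite /set_deg /word_deg -{2}(elts_set_of hw) big_map big_enum /=.
by under eq_bigr do rewrite n_letter.
Qed.

Lemma diff_g w : subseq w (iota 0 4) -> (0 < size w < 4)%N ->
  diff (g w) = split_bracket e g w.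
Proof.
move=> hw sw; have [_ psi_brk psi_diff] := psi_dgl.
rewrite -(morphism_wh_bdry e_letter psi_brk) //; last by case/andP: sw => _ /ltnW.
by rewrite /g /gen_value -psi_diff diff_wh_gen // -size_elts elts_set_of.
Qed.

Lemma g_represents i : (i < 4)%N -> represents (g [:: i]) (x i).
Proof.
move=> hi; have := psi_gen (Ordinal hi); rewrite (tnth_nth 0) /g /gen_value.
have -> // : set_of 4 [:: i] = [set Ordinal hi].
by apply/setP => j; rewrite !inE.
Qed.

Lemma boundary_word_bdry3 i j k : subseq [:: i; j; k] (iota 0 4) ->
  boundary (word_bdry K e y [:: i; j; k]).
Proof.
move=> hw; have /and3P[ij jk _] := sorted_word hw.
have ik := ltn_trans ij jk.
have mem l : l \in [:: i; j; k] -> (l < 4)%N.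
  by move=> /(mem_subseq hw); rewrite mem_iota.
have sub u : subseq u [:: i; j; k] -> subseq u (iota 0 4) by move=> h; apply: subseq_trans h hw.
have s1 l : l \in [:: i; j; k] -> subseq [:: l] [:: i; j; k] by rewrite sub1seq.
have [li lj lk] : [/\ i \in [:: i; j; k], j \in [:: i; j; k] & k \in [:: i; j; k]].
  by rewrite !inE !eqxx ?orbT.
have [sij sik sjk] : [/\ subseq [:: i; j] [:: i; j; k], subseq [:: i; k] [:: i; j; k]
    & subseq [:: j; k] [:: i; j; k]].
  split; first exact: (mask_subseq [:: true; true; false] [:: i; j; k]).
    exact: (mask_subseq [:: true; false; true] [:: i; j; k]).
  exact: (mask_subseq [:: false; true; true] [:: i; j; k]).
have null_g : null_triple (deg i) (deg j) (deg k) (g [:: i]) (g [:: j]) (g [:: k]).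
  exists (g [:: i; j]), (g [:: i; k]), (g [:: j; k]); split.
    have h u v : subseq [:: u; v] [:: i; j; k] -> shifted_homog (deg u + deg v) (g [:: u; v]).
      by move=> /sub/g_homog; rewrite /word_deg big_cons big_seq1.
    by split; apply: h.
  have h u v : (u < v)%N -> subseq [:: u; v] [:: i; j; k] ->
      diff (g [:: u; v]) = sbrk (oddz (deg u)) (g [:: u]) (g [:: v]).
    by move=> ltuv /sub suv; rewrite diff_g // (split_bracket2 g oddz_letter ltuv).
  split; [exact: h|exact: h|exact: h|exists (g [:: i; j; k])].
  by rewrite diff_g // (split_bracket3 g oddz_letter ij jk).
(* the homotopy yields a homogeneous c, which an arbitrary preimage need not be *)
pose c l := K (y l - g [:: l]).
have yE l : l \in [:: i; j; k] -> y l = g [:: l] + diff (c l).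
  move=> /mem l4; have hb := represents_homologous (hr_i_id R (x l)) (g_represents l4).
  by rewrite [diff (c l)](boundary_retract R hb) addrCA subrr addr0.
have hg l : l \in [:: i; j; k] -> shifted_homog (deg l) (g [:: l]).
  by move=> /s1/sub/g_homog; rewrite /word_deg big_seq1.
have hc l : l \in [:: i; j; k] -> homog (deg l) (c l).
  move=> hl; rewrite -[deg l](subrK 1); apply: hr_K_deg; apply: homogB; first exact: y_homog.
  exact: hg.
have dg l : l \in [:: i; j; k] -> diff (g [:: l]) = 0.
  by move=> /mem/g_represents/represents_diff.
rewrite word_bdry3 //; apply: boundary_triple_bracket => //; rewrite ?diff_word_value2 ?y_cycle //.
rewrite !yE //; apply: (null_triple_homologous (hc _ li) (hc _ lj) (hc _ lk)
  (hg _ li) (hg _ lj) (hg _ lk) (dg _ li) (dg _ lj) (dg _ lk) null_g).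
Qed.

Lemma diff_word_value w : subseq w (iota 0 4) -> (size w < 4)%N ->
  diff (word_value K e y w) = word_bdry K e y w.
Proof.
move=> hw; have sw := sorted_word hw.
case: w hw sw => [|i [|j [|k [|l w]]]] // hw sw _.
- by rewrite /word_value /word_bdry /split_bracket /signed_trees /= !big_nil linear0.
- by rewrite word_value1 word_bdry1 y_cycle.
- by rewrite diff_word_value2 ?word_bdry2 //; case/andP: sw.
- by rewrite word_valueE // boundary_retract //; apply: boundary_word_bdry3.
Qed.

Lemma phi_dgl : dgl_morphism phi.
Proof.
split; [exact: free_ext_homog|exact: free_ext_brk|].
apply: wh_morphism_diff; [exact: free_ext_brk|exact: free_ext_homog|].
move=> I; have hI := elts_subseq (val I); have /andP[_ sI] := word_gt0_lt4 I.
rewrite -[val I]set_of_elts phi_wh_bdry // (free_ext_gen word_value_gen_homog) /=.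
by rewrite diff_word_value.
Qed.

Lemma diff_word_bdry4 : diff (word_bdry K e y (iota 0 4)) = 0.
Proof.
by apply: (diff_word_bdry (hr_K_deg R) oddz_letter y_homog) => [A hA sA|];
  [apply: diff_word_value|apply: triples4].
Qed.

(** The class of phi(omega) is a value of the Whitehead bracket. *)
Lemma phi_whitehead : whitehead [tuple d1; d2; d3; d4] [tuple x1; x2; x3; x4]
  (hr_q R (word_bdry K e y (iota 0 4))).
Proof.
exists phi; split; first exact: phi_dgl.
- move=> j; have -> : [set j] = set_of 4 [:: val j] by apply/setP => i; rewrite !inE.
  rewrite phi_wh_gen ?sub1seq ?mem_iota ?ltn_ord // word_value1 (tnth_nth 0).
  exact: hr_i_id.
rewrite /omega -[setT]set_of_elts.
have -> : elts [set: 'I_4] = iota 0 4.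
  by rewrite eltsE; apply/all_filterP/allP => i; rewrite mem_iota /= => hi;
    rewrite -[i]/(val (Ordinal hi)) mem_elts inE.
rewrite phi_wh_bdry //; apply: retract_represents; exact: diff_word_bdry4.
Qed.

End GivenMorphism.

End Main.

Theorem corollary3p7 (L : dglType) (abelian_H : abelian_lie (homology L))
    (x1 x2 x3 x4 : homology L) (d1 d2 d3 d4 : int)
    (hx1 : homog d1 x1) (hx2 : homog d2 x2) (hx3 : homog d3 x3) (hx4 : homog d4 x4)
    (nonempty : exists h : homology L,
       whitehead [tuple d1; d2; d3; d4] [tuple x1; x2; x3; x4] h)
    (R : homotopy_retract L)
    (Ts : seq btree) (hTs : plane_drawings 4 Ts) :
  whitehead [tuple d1; d2; d3; d4] [tuple x1; x2; x3; x4]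
    ((-1) ^ (3 * d1 + 2 * d2 + d3)
       *: transferred R Ts [tuple d1; d2; d3; d4] [tuple x1; x2; x3; x4]).
Proof.
have [_ [psi [psi_dgl psi_gen _]]] := nonempty.
rewrite (transferred4 hTs (y_homog R hx1 hx2 hx3 hx4)) scalerA expN1z sgn_mul scale1r.
exact: (phi_whitehead abelian_H R hx1 hx2 hx3 hx4 psi_dgl psi_gen).
Qed.
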